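(* For every infinite cardinal $\kappa$, let $\mathbf{C}_\kappa$ denote the category $\kappa\text{-}\mathbf{CGrp}/_{\sim}$ and let $\mathcal{W}$ be the family of all equivalence classes (under closeness) of homomorphisms in $\kappa\text{-}\mathbf{CGrp}$ which are coarse equivalences. Then the pair $(\mathbf{C}_\kappa,\mathcal{W})$ is a homotopical category, and thus the localisation $(\mathbf{C}_\kappa[\mathcal{W}^{-1}],Q)$ of $\mathbf{C}_\kappa$ by $\mathcal{W}$ exists and the functor $Q\colon\mathbf{C}_\kappa\to\mathbf{C}_\kappa[\mathcal{W}^{-1}]$ is exact.
   Context: For an infinite cardinal $\kappa$, the $\kappa$-group coarse structure on a group $G$ is the family of all $E\subseteq G\times G$ such that $E\subseteq\{(g,gk)\mid g\in G,k\in K\}$ for some $K\subseteq G$ with $|K|<\kappa$. A coarse structure $\mathcal{E}$ on $G$ is uniformly invariant if $\{(g^{-1}xg,g^{-1}yg)\mid g\in G,(x,y)\in E\}\in\mathcal{E}$ for all $E\in\mathcal{E}$. A map $f\colon(X,\mathcal{E}_X)\to(Y,\mathcal{E}_Y)$ is bornologous if $(f\times f)(E)\in\mathcal{E}_Y$ for all $E\in\mathcal{E}_X$. Maps $f,g\colon X\to(Y,\mathcal{E}_Y)$ are close, $f\sim g$, if $\{(f(x),g(x))\mid x\in X\}\in\mathcal{E}_Y$. A bornologous $f\colon X\to Y$ is a coarse equivalence if there is a bornologous map (not necessarily a homomorphism) $g\colon Y\to X$ with $g\circ f\sim\mathrm{id}_X$ and $f\circ g\sim\mathrm{id}_Y$.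 The category $\kappa\text{-}\mathbf{CGrp}$ has as objects the groups endowed with their $\kappa$-group coarse structure, provided this structure is uniformly invariant, and as morphisms the bornologous homomorphisms. $\kappa\text{-}\mathbf{CGrp}/_\sim$ is its quotient by the closeness congruence: same objects, morphisms are $\sim$-equivalence classes of bornologous homomorphisms. A pair $(\mathcal{X},\mathcal{W})$ of a category and a class of its morphisms is a homotopical category if: (i) $\mathcal{W}$ contains all identities and is closed under composition; (ii) (right Ore condition) for every $w\colon X\to Z$ in $\mathcal{W}$ and every morphism $f\colon Y\to Z$ there are $w'\colon T\to Y$ in $\mathcal{W}$ and a morphism $f'\colon T\to X$ with $w\circ f'=f\circ w'$; (iii) (right cancellability) for every $w\colon Y\to Z$ in $\mathcal{W}$ and $f,g\colon X\to Y$ with $w\circ f=w\circ g$ there is $w'\colon T\to X$ in $\mathcal{W}$ with $f\circ w'=g\circ w'$; (iv) (2-out-of-6) for composable $f\colon X\to Y$, $g\colon Y\to Z$, $h\colon Z\to T$, if $g\circ f$ and $h\circ g$ are in $\mathcal{W}$ then so are $f,g,h$. A localisation of $\mathcal{X}$ by $\mathcal{W}$ is a category $\mathcal{X}[\mathcal{W}^{-1}]$ with a functor $Q\colon\mathcal{X}\to\mathcal{X}[\mathcal{W}^{-1}]$ such that: $Q(w)$ is an isomorphism for all $w\in\mathcal{W}$; every functor $F\colon\mathcal{X}\to\mathcal{Y}$ sending all elements of $\mathcal{W}$ to isomorphisms is naturally isomorphic to $F_{\mathcal{W}}\circ Q$ for some functor $F_{\mathcal{W}}\colon\mathcal{X}[\mathcal{W}^{-1}]\to\mathcal{Y}$;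 and for every category $\mathcal{Y}$ the functor $-\circ Q\colon\mathrm{Funct}(\mathcal{X}[\mathcal{W}^{-1}],\mathcal{Y})\to\mathrm{Funct}(\mathcal{X},\mathcal{Y})$ is full and faithful. A functor is exact if it preserves all finite limits and finite colimits that exist in its source. *)

(* Defs.v *)
From HB Require Import structures.
From mathcomp Require Import all_boot.
From mathcomp Require Import boolp classical_sets functions cardinality.

Set Implicit Arguments.
Unset Strict Implicit.
Unset Printing Implicit Defensive.

Local Open Scope classical_set_scope.
Local Open Scope card_scope.

Definition card_lt T U (A : set T) (B : set U) := (A #<= B) && (A #!= B).
Notation "A '#<' B" := (card_lt A B) (at level 79) : card_scope.

Lemma inj_card_leP T U (A : set T) (B : set U) (f : T -> U) :
  (forall x, A x -> B (f x)) ->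
  (forall x y, A x -> A y -> f x = f y -> x = y) -> A #<= B.
Proof.
move=> fAB finj.
have : $|{injfun A >-> B}|.
  apply/injfunPex; exists f; first by move=> x; exact: fAB.
  by move=> x y /set_mem Ax /set_mem Ay; exact: finj.
by move=> [g]; exact: inj_card_le.
Qed.

Lemma card_le_inj T U (A : set T) (B : set U) (b0 : B !=set0) : A #<= B ->
  exists f : T -> U, (forall x, A x -> B (f x)) /\
    (forall x y, A x -> A y -> f x = f y -> x = y).
Proof.
move=> /card_leP[g].
have /choice[f fP] : forall x, exists y, forall Ax : x \in A,
    y = val (g (SigSub Ax)).
  move=> x; have [Ax|nAx] := pselect (x \in A).
    by exists (val (g (SigSub Ax))) => Ax'; rewrite (bool_irrelevance Ax Ax').
  by case: b0 => b _; exists b => Ax; case: nAx.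
exists f; split=> [x /mem_set Ax|x y /mem_set Ax /mem_set Ay].
  by rewrite (fP _ Ax); exact/set_mem/valP.
rewrite (fP _ Ax) (fP _ Ay) => /val_inj /inj.
by rewrite !in_setT => /(_ isT isT) [].
Qed.

Lemma card_le_total T U (A : set T) (B : set U) : (A #<= B) \/ (B #<= A).
Proof.
have [A0|/nonemptyPn ->] := pselect (A !=set0); last by left; exact: card_ge0.
have [B0|/nonemptyPn ->] := pselect (B !=set0); last by right; exact: card_ge0.
case: A0 B0 => a0 Aa0 [b0 Bb0].
pose P (R : set (T * U)) := [/\ forall x y, R (x, y) -> A x /\ B y,
  forall x y y', R (x, y) -> R (x, y') -> y = y' &
  forall x x' y, R (x, y) -> R (x', y) -> x = x'].
have [|R [[RAB Rfun Rinj] Rmax]] := @Zorn_bigcup _ P.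
  move=> F FP Ftot; split=> [x y [X FX] Xxy|x y y' [X FX] Xxy [Y FY] Yxy|].
  - by have [+ _ _] := FP _ FX; exact.
  - have [XY|YX] := Ftot _ _ FX FY.
      by have [_ + _] := FP _ FY; apply; [exact: XY Xxy|exact: Yxy].
    by have [_ + _] := FP _ FX; apply; [exact: Xxy|exact: YX Yxy].
  - move=> x x' y [X FX] Xxy [Y FY] Yxy.
    have [XY|YX] := Ftot _ _ FX FY.
      by have [_ _] := FP _ FY; apply; [exact: XY Xxy|exact: Yxy].
    by have [_ _] := FP _ FX; apply; [exact: Xxy|exact: YX Yxy].
have [Rtot|] := pselect (forall x, A x -> exists y, R (x, y)).
  left; have /choice[f fP] : forall x, exists y, A x -> R (x, y).
    move=> x; have [/Rtot[y]|] := pselect (A x); first by exists y.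
    by exists b0.
  apply: (@inj_card_leP _ _ _ _ f) => [x /fP/RAB[]//|x y /fP Rx /fP Ry fxy].
  by apply: Rinj Rx _; rewrite fxy.
move=> /existsNP[a /not_implyP[Aa /forallNP Ra]].
have [Rsur|] := pselect (forall y, B y -> exists x, R (x, y)).
  right; have /choice[f fP] : forall y, exists x, B y -> R (x, y).
    move=> y; have [/Rsur[x]|] := pselect (B y); first by exists x.
    by exists a0.
  apply: (@inj_card_leP _ _ _ _ f) => [x /fP/RAB[]//|x y /fP Rx /fP Ry fxy].
  by apply: Rfun Rx _; rewrite fxy.
move=> /existsNP[b /not_implyP[Bb /forallNP Rb]].
exfalso; apply: (Rmax (R `|` [set (a, b)])).
  split; first by move=> p; left.
  by move=> /(_ (a, b) (or_intror erefl)) /Ra.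
split.
- by move=> x y [/RAB//|[-> ->]].
- move=> x y y' Rxy Rxy'; case: Rxy => [Rxy|[xa yb]]; case: Rxy' => [Rxy'|[xa' yb']].
  + exact: Rfun Rxy Rxy'.
  + by rewrite xa' in Rxy; case: (Ra _ Rxy).
  + by rewrite xa in Rxy'; case: (Ra _ Rxy').
  + by rewrite yb yb'.
- move=> x x' y Rxy Rxy'; case: Rxy => [Rxy|[xa yb]]; case: Rxy' => [Rxy'|[xa' yb']].
  + exact: Rinj Rxy Rxy'.
  + by rewrite yb' in Rxy; case: (Rb _ Rxy).
  + by rewrite yb in Rxy'; case: (Rb _ Rxy').
  + by rewrite xa xa'.
Qed.

Lemma infinite_inj T (A : set T) : infinite_set A ->
  exists e : nat -> T, (forall n, A (e n)) /\ injective e.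
Proof.
move=> Ainf; have A0 : A !=set0.
  by apply: contrapT => /nonemptyPn A0; apply: Ainf; rewrite A0.
move/infiniteP: Ainf => /(card_le_inj A0)[e [eA einj]].
by exists e; split=> [n|m n]; [exact: eA|exact: einj].
Qed.

(* Hessenberg's theorem, by Zorn's lemma on partial injections S x S -> S *)
Lemma card_le_square T (A : set T) : infinite_set A -> A `*` A #<= A.
Proof.
move=> Ainf; pose S (G : set (T * T * T)) := [set x | exists z, G (x, x, z)].
pose good (G : set (T * T * T)) := [/\ forall p z z', G (p, z) -> G (p, z') -> z = z',
  forall p p' z, G (p, z) -> G (p', z) -> p = p',
  forall x y, (exists z, G (x, y, z)) <-> S G x /\ S G y,
  forall p z, G (p, z) -> S G z & S G `<=` A].
pose P G := good G /\ forall g, G g -> infinite_set (S G).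
have SG G G' : G `<=` G' -> S G `<=` S G'.
  by move=> GG' x [z] /GG'; exists z.
have [F FP Ftot|G [[Ggood Ginf] Gmax]] := @Zorn_bigcup _ P.
  have F2 X Y : F X -> F Y -> exists Z, [/\ F Z, X `<=` Z & Y `<=` Z].
    by move=> FX FY; have [XY|YX] := Ftot _ _ FX FY; [exists Y|exists X]; split.
  have FU X : F X -> X `<=` \bigcup_(Y in F) Y by move=> FX; exact: bigcup_sup.
  split; last first.
    move=> g [X FX Xg]; apply: (@sub_infinite_set _ (S X)).
      exact/SG/FU.
    by have [_ /(_ _ Xg)] := FP _ FX.
  split.
  - move=> p z z' [X FX Xp] [Y FY Yp]; have [Z [FZ XZ YZ]] := F2 _ _ FX FY.
    by have [[Zf _ _ _ _] _] := FP _ FZ; apply: Zf; [exact: XZ Xp|exact: YZ Yp].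
  - move=> p z z' [X FX Xp] [Y FY Yp]; have [Z [FZ XZ YZ]] := F2 _ _ FX FY.
    by have [[_ Zf _ _ _] _] := FP _ FZ; apply: Zf; [exact: XZ Xp|exact: YZ Yp].
  - move=> x y; split=> [[z [X FX Xz]]|[[z [X FX Xz]] [z' [Y FY Yz']]]].
      have [[_ _ Xd _ _] _] := FP _ FX.
      have [Sx Sy] : S X x /\ S X y by apply/Xd; exists z.
      by split; apply: (SG _ _ (FU _ FX)).
    have [Z [FZ XZ YZ]] := F2 _ _ FX FY.
    have [[_ _ Zd _ _] _] := FP _ FZ.
    have [|t Zt] := (Zd x y).2; last by exists t, Z.
    by split; [exists z; exact: XZ|exists z'; exact: YZ].
  - move=> p z [X FX Xp]; have [[_ _ _ Xv _] _] := FP _ FX.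
    by apply: (SG _ _ (FU _ FX)); exact: Xv Xp.
  - move=> x [z [X FX Xp]]; have [[_ _ _ _ XA] _] := FP _ FX.
    by apply: XA; exists z.
have [Gfun Ginj Gdom Gval GA] := Ggood.
have Sinf : infinite_set (S G).
  have [[g Gg]|/nonemptyPn G0] := pselect (G !=set0); first exact: Ginf Gg.
  have [e [eA einj]] := infinite_inj Ainf.
  pose G1 : set (T * T * T) :=
    [set g | exists i j, g = (e i, e j, e (choice.pickle (i, j)))].
  have SG1 x : S G1 x <-> exists i, x = e i.
    split=> [[z [i [j [-> _ _]]]]|[i ->]]; first by exists i.
    by exists (e (choice.pickle (i, i))), i, i.
  exfalso; apply: (Gmax G1).
    split; first by rewrite G0.
    by rewrite G0 => /(_ (e 0, e 0, e (choice.pickle (0, 0)))); apply; exists 0, 0.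
  split; last first.
    move=> _ _; apply/infiniteP; apply: (@inj_card_leP _ _ _ _ e) => [i _|i j _ _ /einj//].
    by apply/SG1; exists i.
  split.
  - move=> p z z' [i [j [-> ->]]] [i' [j' [/einj -> /einj -> ->]]] //.
  - move=> p p' z [i [j [-> ->]]] [i' [j' [->]]].
    by move=> /einj /(pcan_inj choice.pickleK) [-> ->].
  - move=> x y; rewrite !SG1; split=> [[z [i [j [-> -> _]]]]|[[i ->] [j ->]]].
      by split; [exists i|exists j].
    by exists (e (choice.pickle (i, j))), i, j.
  - by move=> p z [i [j [_ ->]]]; apply/SG1; eexists.
  - by move=> x /SG1[i ->].
have [c [cS cinj]] := infinite_inj Sinf.
have /choice[f fP] : forall p, exists z, S G p.1 -> S G p.2 -> G (p, z).
  move=> [x y]; have [Sxy|nS] := pselect (S G x /\ S G y).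
    by have [z] := (Gdom x y).2 Sxy; exists z.
  by exists x => Sx Sy; case: nS.
have fS x y : S G x -> S G y -> S G (f (x, y)).
  by move=> Sx Sy; apply: Gval; exact: fP.
have finj x y x' y' : S G x -> S G y -> S G x' -> S G y' ->
    f (x, y) = f (x', y') -> x = x' /\ y = y'.
  move=> Sx Sy Sx' Sy' ff; suff [-> ->] : (x, y) = (x', y') by [].
  by apply: Ginj (fP (x, y) Sx Sy) _; rewrite ff; exact: fP.
have S0 : S G !=set0 by exists (c 0).
have [/(card_le_inj S0)[g [gS ginj]]|] := card_le_total (A `\` S G) (S G).
  have /choice[h hP] : forall x, exists z, (S G x -> z = f (x, c 0)) /\
      (~ S G x -> z = f (g x, c 1)).
    move=> x; have [Sx|nSx] := pselect (S G x).
      by exists (f (x, c 0)); split.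
    by exists (f (g x, c 1)); split.
  have hS x : A x -> S G (h x).
    move=> Ax; have [Sx|nSx] := pselect (S G x).
      by rewrite (hP x).1//; exact: fS.
    by rewrite (hP x).2//; apply: fS => //; exact: gS.
  have hinj x y : A x -> A y -> h x = h y -> x = y.
    move=> Ax Ay; have [Sx|nSx] := pselect (S G x);
      have [Sy|nSy] := pselect (S G y).
    - by rewrite (hP x).1// (hP y).1// => /finj[].
    - rewrite (hP x).1// (hP y).2// => /finj[]//; first exact: gS.
      by move=> _ /cinj.
    - rewrite (hP x).2// (hP y).1// => /finj[]//; first exact: gS.
      by move=> _ /cinj.
    - rewrite (hP x).2// (hP y).2// => /finj[]//; [exact: gS|exact: gS|].
      by move=> + _; apply: ginj.
  apply: (@inj_card_leP _ _ _ _ (fun p => f (h p.1, h p.2))).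
    by move=> [x y] [/= Ax Ay]; apply: GA; apply: fS; exact: hS.
  move=> [x y] [x' y'] [/= Ax Ay] [/= Ax' Ay'] /finj[]; try exact: hS.
  by move=> /hinj -> // /hinj ->.
move=> SAS; exfalso.
have [AS0|/nonemptyPn AS0] := pselect (A `\` S G !=set0); last first.
  by apply: Sinf; move: SAS; rewrite AS0 => /card_le0P ->.
have [j [jAS jinj]] := card_le_inj AS0 SAS.
have jA s : S G s -> A (j s) by move=> /jAS[].
have jS s : S G s -> ~ S G (j s) by move=> /jAS[].
pose S' := S G `|` j @` S G.
have /choice[r rP] : forall x, exists y,
    (S G x -> y = x) /\ (forall s, S G s -> x = j s -> y = s).
  move=> x; have [Sx|nSx] := pselect (S G x).
    by exists x; split=> // s Ss xs; case: (jS s Ss); rewrite -xs.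
  have [[s Ss js]|ns] := pselect ((j @` S G) x).
    by exists s; split=> // s' Ss' xs'; apply: jinj => //; rewrite js.
  by exists x; split=> // s Ss xs; case: ns; exists s.
have rS x : S' x -> S G (r x).
  by move=> [Sx|[s Ss <-]]; [rewrite (rP x).1|rewrite ((rP (j s)).2 s)].
pose tag x y := c (`[< S G x >]%B.*2 + `[< S G y >]%B).
have rinj x y : S' x -> S' y -> `[< S G x >] = `[< S G y >] -> r x = r y -> x = y.
  move=> [Sx|[s Ss <-]] [Sy|[t St <-]].
  - by rewrite (rP x).1// (rP y).1.
  - by rewrite (asboolT Sx) (asboolF (@jS t St)).
  - by rewrite (asboolT Sy) (asboolF (@jS s Ss)).
  - by rewrite ((rP (j s)).2 s)// ((rP (j t)).2 t)// => _ ->.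
pose k x y := j (f (f (r x, r y), tag x y)).
have kinj x y x' y' : S' x -> S' y -> S' x' -> S' y' -> k x y = k x' y' ->
    x = x' /\ y = y'.
  move=> Sx Sy Sx' Sy' /jinj; rewrite /tag.
  have fr u v : S' u -> S' v -> S G (f (r u, r v)).
    by move=> Su Sv; apply: fS; exact: rS.
  move=> H; have {H} : f (f (r x, r y), tag x y) = f (f (r x', r y'), tag x' y').
    by apply: H; apply: fS; try exact: fr.
  move=> /finj[]; rewrite /tag//; try exact: fr.
  move=> /finj[]; try exact: rS.
  move=> rx ry /cinj tt; split; apply: rinj => //; move: tt;
    by case: `[< S G x >]; case: `[< S G x' >]; case: `[< S G y >]; case: `[< S G y' >].
pose G2 : set (T * T * T) := G `|` [set g | [/\ S' g.1.1, S' g.1.2,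
  ~ (S G g.1.1 /\ S G g.1.2) & g.2 = k g.1.1 g.1.2]].
have kS x y : S' x -> S' y -> (j @` S G) (k x y).
  move=> Sx Sy; exists (f (f (r x, r y), tag x y)) => //.
  by apply: (fS); [apply: fS; exact: rS|exact: cS].
have SG2 x : S G2 x <-> S' x.
  split=> [[z [Gx|[//]]]|]; first by left; exists z.
  have [Sx _|nSx Sx] := pselect (S G x); first exact: (@SG _ _ (@subsetUl _ G _)).
  by exists (k x x); right; split=> //= -[].
apply: (Gmax G2).
  split; first by move=> g; left.
  move=> /(_ (j (c 0), j (c 0), k (j (c 0)) (j (c 0)))) H.
  have Sj : S' (j (c 0)) by right; exists (c 0).
  apply: (@jS (c 0)) => //; exists (k (j (c 0)) (j (c 0))); apply: H.
  by right; split=> //= -[H1 _]; exact: (jS _ (cS 0) H1).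
split; last first.
  move=> _ _; apply: (@sub_infinite_set _ (S G)) => //.
  by move=> x Sx; apply/SG2; left.
have GSS x y z : G (x, y, z) -> S G x /\ S G y by move=> Gxy; apply/Gdom; exists z.
have jSn z : (j @` S G) z -> ~ S G z by move=> [s Ss <-]; exact: jS.
split.
- move=> [x y] z z' [Gz|[/= Sx Sy nS ->]] [Gz'|[/= Sx' Sy' nS' ->]] //.
  + exact: Gfun Gz Gz'.
  + by case: nS'; exact: GSS Gz.
  + by case: nS; exact: GSS Gz'.
- move=> [x y] [x' y'] z [Gz|[/= Sx Sy nS zk]] [Gz'|[/= Sx' Sy' nS' zk']].
  + exact: Ginj Gz Gz'.
  + by case: (@jSn z); [rewrite zk'; exact: kS|exact: Gval Gz].
  + by case: (@jSn z); [rewrite zk; exact: kS|exact: Gval Gz'].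
  + have Hk : k x y = k x' y' by rewrite -zk -zk'.
    by have [-> ->] := kinj _ _ _ _ Sx Sy Sx' Sy' Hk.
- move=> x y; rewrite !SG2; split=> [[z [/GSS[Sx Sy]|[//]]]|[Sx Sy]].
    by split; left.
  have [/Gdom[z Gz]|nS] := pselect (S G x /\ S G y); first by exists z; left.
  by exists (k x y); right.
- move=> [x y] z [/Gval Sz|[/= Sx Sy _ ->]]; apply/SG2; first by left.
  by right; exact: kS.
- by move=> x /SG2[/GA//|[s Ss <-]]; exact: jA.
Qed.

Lemma card_ltNge T U (A : set T) (B : set U) : (A #< B) = ~~ (B #<= A).
Proof.
rewrite /card_lt card_eq_le; have [BA|nBA] := boolP (B #<= A).
  by rewrite andbT andbN.
by rewrite andbF andbT; case: (card_le_total A B) => // BA; rewrite BA in nBA.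
Qed.

Lemma card_le_lt_trans T U V (A : set T) (B : set U) (C : set V) :
  A #<= B -> B #< C -> A #< C.
Proof.
rewrite !card_ltNge => AB; apply: contra => CA; exact: card_le_trans CA AB.
Qed.

Lemma card_lt_setX (kappa : Type) T U (A : set T) (B : set U) :
  infinite_set [set: kappa] -> A #< [set: kappa] -> B #< [set: kappa] ->
  A `*` B #< [set: kappa].
Proof.
move=> kinf.
have wlog T' U' (A' : set T') (B' : set U') : A' #<= B' -> B' #< [set: kappa] ->
    A' `*` B' #< [set: kappa].
  move=> AB Bk; have [Bfin|Binf] := pselect (finite_set B').
    rewrite card_ltNge; apply/negP => /card_le_finite kfin; apply: kinf.
    by apply: kfin; apply: finite_setX => //; exact: card_le_finite AB Bfin.
  apply: card_le_lt_trans Bk; apply: card_le_trans (card_le_square Binf).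
  have B0 : B' !=set0 by have [e [eB _]] := infinite_inj Binf; exists (e 0).
  have [f [fB finj]] := card_le_inj B0 AB.
  apply: (@inj_card_leP _ _ _ _ (fun p => (f p.1, p.2))).
    by move=> [x y] [/= Ax By]; split=> //=; exact: fB.
  by move=> [x y] [x' y'] [/= Ax By] [/= Ax' By'] [/finj -> // ->].
move=> Ak Bk; have [AB|BA] := card_le_total A B; first exact: wlog.
apply: card_le_lt_trans (wlog _ _ _ _ BA Ak).
apply: (@inj_card_leP _ _ _ _ (fun p => (p.2, p.1))).
  by move=> [x y] [/= Ax By]; split.
by move=> [x y] [x' y'] _ _ [-> ->].
Qed.

Section CoarseStructures.

Definition bornologous X Y (EX : set (set (X * X))) (EY : set (set (Y * Y)))
    (f : X -> Y) :=
  forall E, EX E -> EY ((fun p => (f p.1, f p.2)) @` E).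

Definition close X Y (EY : set (set (Y * Y))) (f g : X -> Y) :=
  EY [set (f x, g x) | x in [set: X]].

Definition coarse_equivalence X Y (EX : set (set (X * X)))
    (EY : set (set (Y * Y))) (f : X -> Y) :=
  bornologous EX EY f /\
  exists g : Y -> X, [/\ bornologous EY EX g,
    close EX (g \o f) id & close EY (f \o g) id].

Local Open Scope group_scope.

(* The cardinal kappa is represented by a type of that cardinality, so that
   |K| < kappa reads K #< [set: kappa] *)
Definition group_coarse (kappa : Type) (G : groupType) : set (set (G * G)) :=
  [set E | exists2 K : set G, K #< [set: kappa] &
    E `<=` [set (g, g * k) | g in [set: G] & k in K]].

Definition uniformly_invariant (G : groupType) (EG : set (set (G * G))) :=
  forall E, EG E ->
    EG [set (g^-1 * p.1 * g, g^-1 * p.2 * g) | g in [set: G] & p in E].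

End CoarseStructures.

(* Universes: Obj and Hom live strictly above the carriers of groupType, because
   the category of all groups does. The universes of classical_sets' [set] and
   of [finite_set] are bounded by those of the algebraic structures, so
   predicates on objects and morphisms below are plain functions into Prop, and
   finiteness of a category is phrased with 'I_n. Hom-types are not assumed
   smaller than Obj: categories need not be locally small. *)
Record category := Category {
  Obj :> Type;
  Hom : Obj -> Obj -> Type;
  idc : forall X, Hom X X;
  comp : forall X Y Z, Hom Y Z -> Hom X Y -> Hom X Z;
  comp1c : forall X Y (f : Hom X Y), comp (idc Y) f = f;
  compc1 : forall X Y (f : Hom X Y), comp f (idc X) = f;
  compA : forall X Y Z T (h : Hom Z T) (g : Hom Y Z) (f : Hom X Y),
    comp h (comp g f) = comp (comp h g) f
}.
Arguments Hom {c} X Y.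
Arguments idc {c} X.
Arguments comp {c X Y Z} g f.

Declare Scope cat_scope.
Delimit Scope cat_scope with cat.
Local Open Scope cat_scope.
Notation "g \oc f" := (comp g f) (at level 40, left associativity) : cat_scope.

Definition is_iso (C : category) (X Y : C) (f : Hom X Y) :=
  exists g : Hom Y X, g \oc f = idc X /\ f \oc g = idc Y.

Definition isomorphic (C : category) (X Y : C) :=
  exists f : Hom X Y, is_iso f.

Definition morphism_class (C : category) := forall X Y : C, Hom X Y -> Prop.

Record functor (C D : category) := Functor {
  fobj :> C -> D;
  fmap : forall X Y : C, Hom X Y -> Hom (fobj X) (fobj Y);
  fmap1 : forall X : C, fmap (idc X) = idc (fobj X);
  fmapM : forall (X Y Z : C) (g : Hom Y Z) (f : Hom X Y),
    fmap (g \oc f) = fmap g \oc fmap f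
}.
Arguments fmap {C D} F {X Y} f : rename.

Program Definition functor_comp (C D E : category) (G : functor D E)
    (F : functor C D) : functor C E :=
  @Functor C E (fun X => G (F X)) (fun X Y f => fmap G (fmap F f)) _ _.
Next Obligation. by rewrite !fmap1. Qed.
Next Obligation. by rewrite !fmapM. Qed.

Definition full (C D : category) (F : functor C D) :=
  forall (X Y : C) (g : Hom (F X) (F Y)), exists f : Hom X Y, fmap F f = g.

Definition faithful (C D : category) (F : functor C D) :=
  forall (X Y : C) (f g : Hom X Y), fmap F f = fmap F g -> f = g.

Record nat_trans (C D : category) (F G : functor C D) := NatTrans {
  nt_app :> forall X : C, Hom (F X) (G X);
  nt_nat : forall (X Y : C) (f : Hom X Y),
    nt_app Y \oc fmap F f = fmap G f \oc nt_app X
}.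

Lemma nat_trans_eq (C D : category) (F G : functor C D) (a b : nat_trans F G) :
  (forall X, a X = b X) -> a = b.
Proof.
case: a b => [a an] [b bn] /= ab; have {}ab : a = b by exact: functional_extensionality_dep.
by case: b / ab bn => bn; congr NatTrans; exact: Prop_irrelevance.
Qed.

Program Definition nat_id (C D : category) (F : functor C D) :
    nat_trans F F := @NatTrans C D F F (fun X => idc (F X)) _.
Next Obligation. by rewrite comp1c compc1. Qed.

Program Definition nat_comp (C D : category) (F G H : functor C D)
    (b : nat_trans G H) (a : nat_trans F G) : nat_trans F H :=
  @NatTrans C D F H (fun X => b X \oc a X) _.
Next Obligation. by rewrite -compA nt_nat !compA nt_nat. Qed.

Program Definition functor_category (C D : category) : category :=
  @Category (functor C D) (@nat_trans C D) (@nat_id C D) (@nat_comp C D) _ _ _.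
Next Obligation. by apply: nat_trans_eq => ?; rewrite /= comp1c. Qed.
Next Obligation. by apply: nat_trans_eq => ?; rewrite /= compc1. Qed.
Next Obligation. by apply: nat_trans_eq => ?; rewrite /= compA. Qed.

Program Definition nat_whisker (C D E : category) (Q : functor C D)
    (F G : functor D E) (a : nat_trans F G) :
    nat_trans (functor_comp F Q) (functor_comp G Q) :=
  @NatTrans C E (functor_comp F Q) (functor_comp G Q) (fun X => a (Q X)) _.
Next Obligation. by rewrite nt_nat. Qed.

Program Definition precomposition (C D E : category) (Q : functor C D) :
    functor (functor_category D E) (functor_category C E) :=
  @Functor (functor_category D E) (functor_category C E)
    (fun F => functor_comp F Q) (fun F G a => nat_whisker Q a) _ _.
Next Obligation. exact: nat_trans_eq. Qed.
Next Obligation. exact: nat_trans_eq. Qed.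

Record homotopical (C : category) (W : morphism_class C) : Prop := Homotopical {
  homotopical_id : forall X : C, W X X (idc X);
  homotopical_comp : forall (X Y Z : C) (g : Hom Y Z) (f : Hom X Y),
    W _ _ g -> W _ _ f -> W _ _ (g \oc f);
  homotopical_ore : forall (X Y Z : C) (w : Hom X Z) (f : Hom Y Z), W _ _ w ->
    exists (T : C) (w' : Hom T Y) (f' : Hom T X),
      W _ _ w' /\ w \oc f' = f \oc w';
  homotopical_cancel : forall (X Y Z : C) (w : Hom Y Z) (f g : Hom X Y),
    W _ _ w -> w \oc f = w \oc g ->
    exists (T : C) (w' : Hom T X), W _ _ w' /\ f \oc w' = g \oc w';
  homotopical_2of6 : forall (X Y Z T : C)
      (f : Hom X Y) (g : Hom Y Z) (h : Hom Z T),
    W _ _ (g \oc f) -> W _ _ (h \oc g) -> [/\ W _ _ f, W _ _ g & W _ _ h]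
}.

Definition inverts (C D : category) (W : morphism_class C) (F : functor C D) :=
  forall (X Y : C) (w : Hom X Y), W _ _ w -> is_iso (fmap F w).

Record localisation (C : category) (W : morphism_class C) (L : category)
    (Q : functor C L) : Prop := Localisation {
  localisation_inverts : inverts W Q;
  localisation_factor : forall (D : category) (F : functor C D), inverts W F ->
    exists FW : functor L D,
      @isomorphic (functor_category C D) F (functor_comp FW Q);
  localisation_full : forall D : category, full (precomposition D Q);
  localisation_faithful : forall D : category, faithful (precomposition D Q)
}.

Definition finite_type (T : Type) :=
  exists n (e : 'I_n -> T), forall x, exists i, e i = x.

Definition finite_category (J : category) :=
  finite_type J /\ forall i j : J, finite_type (Hom i j).

Record cone (J C : category) (D : functor J C) := Cone {
  apex : C;
  leg : forall j : J, Hom apex (D j);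
  leg_nat : forall (i j : J) (u : Hom i j), fmap D u \oc leg i = leg j
}.

Definition is_limit (J C : category) (D : functor J C) (c : cone D) :=
  forall c' : cone D, exists! u : Hom (apex c') (apex c),
    forall j, leg c j \oc u = leg c' j.

Record cocone (J C : category) (D : functor J C) := Cocone {
  coapex : C;
  coleg : forall j : J, Hom (D j) coapex;
  coleg_nat : forall (i j : J) (u : Hom i j), coleg j \oc fmap D u = coleg i
}.

Definition is_colimit (J C : category) (D : functor J C) (c : cocone D) :=
  forall c' : cocone D, exists! u : Hom (coapex c) (coapex c'),
    forall j, u \oc coleg c j = coleg c' j.

Program Definition map_cone (J C E : category) (F : functor C E)
    (D : functor J C) (c : cone D) : cone (functor_comp F D) :=
  @Cone J E (functor_comp F D) (F (apex c)) (fun j => fmap F (leg c j)) _.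
Next Obligation. by rewrite -fmapM leg_nat. Qed.

Program Definition map_cocone (J C E : category) (F : functor C E)
    (D : functor J C) (c : cocone D) : cocone (functor_comp F D) :=
  @Cocone J E (functor_comp F D) (F (coapex c)) (fun j => fmap F (coleg c j)) _.
Next Obligation. by rewrite -fmapM coleg_nat. Qed.

Definition exact_functor (C E : category) (F : functor C E) :=
  forall (J : category) (D : functor J C), finite_category J ->
    (forall c : cone D, is_limit c -> is_limit (map_cone F c)) /\
    (forall c : cocone D, is_colimit c -> is_colimit (map_cocone F c)).

Record congruence (C : category) (R : forall X Y : C, Hom X Y -> Hom X Y -> Prop) :
    Prop := Congruence {
  cong_refl : forall (X Y : C) (f : Hom X Y), R X Y f f;
  cong_sym : forall (X Y : C) (f g : Hom X Y), R X Y f g -> R X Y g f;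
  cong_trans : forall (X Y : C) (f g h : Hom X Y),
    R X Y f g -> R X Y g h -> R X Y f h;
  cong_comp : forall (X Y Z : C) (g g' : Hom Y Z) (f f' : Hom X Y),
    R Y Z g g' -> R X Y f f' -> R X Z (g \oc f) (g' \oc f')
}.

Section QuotientCategory.
Variables (C : category) (R : forall X Y : C, Hom X Y -> Hom X Y -> Prop).
Hypothesis RC : congruence R.

(* An equivalence class is the predicate it defines on morphisms; the composite
   of two classes is the class of the composites of representatives. *)
Definition quo_hom (X Y : C) :=
  {A : Hom X Y -> Prop | exists f, A = R f}.

Definition quo_class (X Y : C) (f : Hom X Y) : quo_hom X Y :=
  exist _ (R f) (ex_intro _ f erefl).

Lemma quo_hom_eq (X Y : C) (A B : quo_hom X Y) :
  (forall f, sval A f <-> sval B f) -> A = B.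
Proof.
case: A B => [A Af] [B Bf] /= AB.
have {}AB : A = B by apply/funext => f; exact/propext.
by case: B / AB Bf => Bf; congr exist; exact: Prop_irrelevance.
Qed.

Lemma quo_classP (X Y : C) (f g : Hom X Y) :
  quo_class f = quo_class g <-> R f g.
Proof.
split=> [[->]|Rfg]; first exact: cong_refl.
apply: quo_hom_eq => h /=; split; apply: cong_trans => //.
exact: cong_sym.
Qed.

Lemma quo_class_surj (X Y : C) (A : quo_hom X Y) : exists f, A = quo_class f.
Proof. by case: A => A [f Af]; exists f; apply: quo_hom_eq => g /=; rewrite Af. Qed.

Definition quo_comp_pred (X Y Z : C) (B : quo_hom Y Z) (A : quo_hom X Y)
    (h : Hom X Z) : Prop :=
  exists g f, [/\ sval B g, sval A f & R (g \oc f) h].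

Lemma quo_comp_predE (X Y Z : C) (g : Hom Y Z) (f : Hom X Y) (h : Hom X Z) :
  quo_comp_pred (quo_class g) (quo_class f) h <-> R (g \oc f) h.
Proof.
split=> [[g' [f' [Rg Rf Rh]]]|Rh].
  by apply: cong_trans Rh => //; exact: cong_comp.
by exists g, f; split=> //; exact: cong_refl.
Qed.

Lemma quo_comp_subproof (X Y Z : C) (B : quo_hom Y Z) (A : quo_hom X Y) :
  exists f, quo_comp_pred B A = R f.
Proof.
have [g ->] := quo_class_surj B; have [f ->] := quo_class_surj A.
by exists (g \oc f); apply/funext => h; apply/propext; exact: quo_comp_predE.
Qed.

Definition quo_comp (X Y Z : C) (B : quo_hom Y Z) (A : quo_hom X Y) :
  quo_hom X Z := exist _ (quo_comp_pred B A) (quo_comp_subproof B A).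

Lemma quo_compE (X Y Z : C) (g : Hom Y Z) (f : Hom X Y) :
  quo_comp (quo_class g) (quo_class f) = quo_class (g \oc f).
Proof. by apply: quo_hom_eq => h; exact: quo_comp_predE. Qed.

Program Definition quotient_category : category :=
  @Category C quo_hom (fun X => quo_class (idc X)) quo_comp _ _ _.
Next Obligation.
by have [g ->] := quo_class_surj f; rewrite quo_compE comp1c.
Qed.
Next Obligation.
by have [g ->] := quo_class_surj f; rewrite quo_compE compc1.
Qed.
Next Obligation.
have [f' ->] := quo_class_surj f; have [g' ->] := quo_class_surj g.
by have [h' ->] := quo_class_surj h; rewrite !quo_compE compA.
Qed.

End QuotientCategory.

Section CGrp.
Variable kappa : Type.

Record cgrp := CGrpObj {
  cgrp_group :> groupType;
  cgrp_invariant : uniformly_invariant (@group_coarse kappa cgrp_group)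
}.

(* On groups, {multiplicative G -> H} is the type of group homomorphisms. *)
Record cgrp_hom (G H : cgrp) := CGrpHom {
  cgrp_mor :> {multiplicative G -> H};
  cgrp_bornologous :
    bornologous (@group_coarse kappa G) (@group_coarse kappa H) cgrp_mor
}.

Lemma cgrp_hom_eq (G H : cgrp) (f g : cgrp_hom G H) :
  (forall x, f x = g x) -> f = g.
Proof.
case: f g => [[f [[fM]]] fb] [[g [[gM]]] gb] /= fg.
have {}fg : f = g by exact/funext.
case: g / fg gM gb => gM gb; have -> : gM = fM by exact: Prop_irrelevance.
by congr CGrpHom; exact: Prop_irrelevance.
Qed.

Lemma cgrp_id_bornologous (G : cgrp) :
  bornologous (@group_coarse kappa G) (@group_coarse kappa G) (@idfun G).
Proof. by move=> E [K Kk EK]; exists K => // _ [[x y] /EK + <-]. Qed.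

Lemma cgrp_comp_bornologous (G H L : cgrp) (g : cgrp_hom H L)
    (f : cgrp_hom G H) :
  bornologous (@group_coarse kappa G) (@group_coarse kappa L) (g \o f).
Proof.
move=> E /(cgrp_bornologous f)/(cgrp_bornologous g).
by rewrite image_comp.
Qed.

Definition cgrp_id (G : cgrp) : cgrp_hom G G :=
  @CGrpHom G G idfun (@cgrp_id_bornologous G).

Definition cgrp_comp (G H L : cgrp) (g : cgrp_hom H L) (f : cgrp_hom G H) :
  cgrp_hom G L := @CGrpHom G L (g \o f) (cgrp_comp_bornologous g f).

Program Definition CGrp : category :=
  @Category cgrp cgrp_hom cgrp_id cgrp_comp _ _ _.
Next Obligation. exact: cgrp_hom_eq. Qed.
Next Obligation. exact: cgrp_hom_eq. Qed.
Next Obligation. exact: cgrp_hom_eq. Qed.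

Definition cgrp_close (G H : CGrp) (f g : Hom G H) :=
  close (@group_coarse kappa H) (f : cgrp_hom G H) (g : cgrp_hom G H).

End CGrp.

Lemma group_closeP (kappa T : Type) (G : groupType) (f g : T -> G) :
  close (@group_coarse kappa G) f g <->
  [set ((f x)^-1 * g x)%g | x in [set: T]] #< [set: kappa].
Proof.
split=> [[K Kk fgK]|fgk].
  apply: card_le_lt_trans Kk; apply: subset_card_le => _ [x _ <-].
  have [|h _ [k Kk [<- <-]]] := fgK (f x, g x); first by exists x.
  by rewrite mulKg.
eexists; first exact: fgk.
by move=> _ [x _ <-]; exists (f x) => //; exists ((f x)^-1 * g x)%g;
  [exists x|rewrite mulVKg].
Qed.

Lemma group_close_trans (kappa T : Type) (G : groupType) (f g h : T -> G) :
  infinite_set [set: kappa] ->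
  close (@group_coarse kappa G) f g -> close (@group_coarse kappa G) g h ->
  close (@group_coarse kappa G) f h.
Proof.
move=> kinf /group_closeP fg /group_closeP gh; apply/group_closeP.
apply: card_le_lt_trans (card_lt_setX kinf fg gh).
apply: card_le_trans (card_image_le (fun p => p.1 * p.2)%g _).
apply: subset_card_le => _ [x _ <-].
exists ((f x)^-1 * g x, (g x)^-1 * h x)%g; first by split; exists x.
by rewrite /= -mulgA mulVKg.
Qed.

Lemma cgrp_close_congruence (kappa : Type) (kinf : infinite_set [set: kappa]) :
  congruence (@cgrp_close kappa).
Proof.
split.
- move=> G H f; apply/group_closeP.
  rewrite card_ltNge; apply/negP => /card_le_finite kfin; apply: kinf; apply: kfin.
  by apply: (sub_finite_set _ (finite_set1 1%g)) => _ [x _ <-]; rewrite mulVg.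
- move=> G H f g /group_closeP fg; apply/group_closeP.
  apply: card_le_lt_trans fg.
  apply: card_le_trans (card_image_le (fun x => x^-1)%g _); apply: subset_card_le.
  by move=> _ [x _ <-]; exists ((f x)^-1 * g x)%g; [exists x|rewrite invgM invgK].
- by move=> G H f g h; exact: group_close_trans.
- move=> G H L g g' f f' gg' ff'.
  apply: (@group_close_trans _ _ _ _ (fun x => g' (f x))) => //.
    move/group_closeP: gg' => gg'; apply/group_closeP.
    apply: card_le_lt_trans gg'; apply: subset_card_le => _ [x _ <-].
    by exists (f x).
  have := cgrp_bornologous g' ff'; rewrite image_comp.
  exact.
Qed.

Definition CGrpQ (kappa : Type) (kinf : infinite_set [set: kappa]) : category :=
  quotient_category (cgrp_close_congruence kinf).

Definition coarse_equivalence_classes (kappa : Type)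
    (kinf : infinite_set [set: kappa]) : morphism_class (CGrpQ kinf) :=
  fun G H A => exists f : cgrp_hom G H,
    A = quo_class (@cgrp_close kappa) f /\
    coarse_equivalence (@group_coarse kappa G) (@group_coarse kappa H) f.
Arguments coarse_equivalence_classes {kappa} kinf X Y _.

(* Main.v *)
From HB Require Import structures.
From mathcomp Require Import all_boot boolp classical_sets functions cardinality.
Require Import Defs.

(** Call a set small if its cardinality is below kappa.  A homomorphism of groups
    is bornologous, and it is a coarse equivalence exactly when its kernel is
    small and its image has few cosets ([coarse_equivalenceP]).  From this
    description one reads off the 2-out-of-6 property, and the right Ore condition
    follows by taking pullbacks of groups ([pullback_equivalence]).  As the kernel is
    small, coarse equivalences are even monic up to closeness ([equivalence_monic]).

    A localisation is found inside the category of bornologous maps up to closeness: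
    it consists of the maps that become homomorphisms, up to closeness, after
    composition with a coarse equivalence ([fraction_map]).  Each of its morphisms
    is a right fraction, and the source category embeds in it faithfully; these
    properties ([fraction_functor]) imply the universal property
    ([fraction_functor_localisation]) and are shared by all localisations
    ([localisation_fraction_functor]).  A finite diagram of fractions has a common
    denominator, so finite limits are preserved ([fraction_functor_limit]).

    Preservation of finite colimits is the dual statement and needs left fractions,
    that is, the left Ore condition: given a coarse equivalence w from Z to X and a
    homomorphism f from Z to Y, there are f' from X and a coarse equivalence w' from Y
    with f' w = w' f ([left_ore]).  The pushout of groups is too large for
    this.  The key fact is that each small subset of an object becomes
    central modulo a small normal subgroup ([small_commutators]).  For uncountable
    kappa this is clear; for countable kappa it is a form of the theorems of
    Dietzmann and Schur on groups with finite conjugacy classes.  Passing to such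
    quotients of X and Y, the representatives of the cosets of w(Z) in X may
    be assumed central, and likewise the image under f of the cocycle that they
    define.  The wanted group is then a central product of Y with a central subgroup
    of X containing the representatives ([extension]). *)

Set Implicit Arguments.
Unset Strict Implicit.
Unset Printing Implicit Defensive.

Local Open Scope classical_set_scope.
Local Open Scope card_scope.
Local Open Scope group_scope.
Local Open Scope cat_scope.

(** * Isomorphisms and fraction functors *)

Lemma iso_id (C : category) (X : C) : is_iso (idc X).
Proof. by exists (idc X); rewrite comp1c. Qed.

Lemma iso_comp (C : category) (X Y Z : C) (g : Hom Y Z) (f : Hom X Y) :
  is_iso g -> is_iso f -> is_iso (g \oc f).
Proof.
move=> [g' [g'g gg']] [f' [f'f ff']]; exists (f' \oc g'); split.
  by rewrite compA -(compA f') g'g compc1.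
by rewrite compA -(compA g) ff' compc1.
Qed.

Lemma iso_epic (C : category) (X Y Z : C) (f : Hom X Y) (g h : Hom Y Z) :
  is_iso f -> g \oc f = h \oc f -> g = h.
Proof. by move=> [f' [_ ff']] /(congr1 (comp^~ f')); rewrite -!compA ff' !compc1. Qed.

Lemma iso_monic (C : category) (X Y Z : C) (f : Hom Y Z) (g h : Hom X Y) :
  is_iso f -> f \oc g = f \oc h -> g = h.
Proof. by move=> [f' [f'f _]] /(congr1 (comp f')); rewrite !compA f'f !comp1c. Qed.

Lemma fmap_iso (C D : category) (F : functor C D) (X Y : C) (f : Hom X Y) :
  is_iso f -> is_iso (fmap F f).
Proof.
by move=> [g [gf fg]]; exists (fmap F g); rewrite -!fmapM gf fg !fmap1.
Qed.

(** What the calculus of right fractions gives for a localisation, in the case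
    where the inverted morphisms are epic: then no two morphisms of the source
    category become equal, whence [fraction_faithful].  These properties are
    invariant under equivalence of the target, so they can be read off from one
    model and hold for every localisation. *)
Record fraction_functor (C : category) (W : morphism_class C) (L : category)
    (Q : functor C L) : Prop := FractionFunctor {
  fraction_inverts : inverts W Q;
  fraction_faithful : faithful Q;
  fraction_surj : forall A : L, exists X : C, isomorphic (Q X) A;
  fraction_exists : forall (X Y : C) (u : Hom (Q X) (Q Y)),
    exists (T : C) (w : Hom T X) (f : Hom T Y),
      W _ _ w /\ u \oc fmap Q w = fmap Q f
}.

(** * The universal property of a fraction functor *)

Section Extension.
Variables (C : category) (W : morphism_class C) (L : category) (Q : functor C L).
Hypotheses (hW : homotopical W) (hQ : fraction_functor W Q).
Variables (D : category) (F : functor C D).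
Hypothesis FW : inverts W F.

(** The graph of the action of an extension of [F] on morphisms of the
    localisation.  Testing against every [a], not only against those in [W],
    makes compatibility with composition immediate. *)
Definition transports (X Y : C) (u : Hom (Q X) (Q Y)) (t : Hom (F X) (F Y)) :=
  forall (T : C) (a : Hom T X) (b : Hom T Y),
    u \oc fmap Q a = fmap Q b -> t \oc fmap F a = fmap F b.

(** If [u] is the fraction [f / w], the only candidate is [F f / F w]; the Ore
    condition, applied to a test morphism [a] and to [w], shows that it works. *)
Lemma transports_exists (X Y : C) (u : Hom (Q X) (Q Y)) :
  exists t, transports u t.
Proof.
have [T [w [f [Ww uw]]]] := fraction_exists hQ u.
have [v [vw wv]] := FW Ww.
exists (fmap F f \oc v) => T' a b ua.
have [T'' [w' [a' [Ww' wa]]]] := homotopical_ore hW a Ww.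
apply: (iso_epic (FW Ww')); rewrite -!compA -!fmapM -wa fmapM (compA v) vw comp1c -fmapM.
congr fmap; apply: (fraction_faithful hQ).
by rewrite !fmapM -uw -ua -!compA -!fmapM wa.
Qed.

Lemma transports_unique (X Y : C) (u : Hom (Q X) (Q Y)) t t' :
  transports u t -> transports u t' -> t = t'.
Proof.
have [T [w [f [Ww uw]]]] := fraction_exists hQ u.
by move=> tu tu'; apply: (iso_epic (FW Ww)); rewrite (tu _ _ _ uw) (tu' _ _ _ uw).
Qed.

Lemma transports_fmap (X Y : C) (f : Hom X Y) : transports (fmap Q f) (fmap F f).
Proof.
by move=> T a b; rewrite -!fmapM => /(fraction_faithful hQ) ->.
Qed.

Lemma transports_comp (X Y Z : C) (v : Hom (Q Y) (Q Z)) (u : Hom (Q X) (Q Y)) s t :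
  transports v s -> transports u t -> transports (v \oc u) (s \oc t).
Proof.
move=> sv tu T a b vua.
have [T' [w [f [Ww uaw]]]] := fraction_exists hQ (u \oc fmap Q a).
apply: (iso_epic (FW Ww)).
rewrite -!compA -!fmapM (tu _ _ f); last by rewrite fmapM compA.
by apply: sv; rewrite -uaw fmapM -vua !compA.
Qed.

Definition extend (X Y : C) (u : Hom (Q X) (Q Y)) : Hom (F X) (F Y) :=
  sval (cid (transports_exists u)).

Lemma extendP (X Y : C) (u : Hom (Q X) (Q Y)) : transports u (extend u).
Proof. by rewrite /extend; case: cid. Qed.
Arguments extendP {X Y} u.

Lemma extend_fmap (X Y : C) (f : Hom X Y) : extend (fmap Q f) = fmap F f.
Proof. exact: (transports_unique (extendP _) (@transports_fmap _ _ f)). Qed.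

Lemma extend_comp (X Y Z : C) (v : Hom (Q Y) (Q Z)) (u : Hom (Q X) (Q Y)) :
  extend (v \oc u) = extend v \oc extend u.
Proof.
exact: (transports_unique (extendP _) (transports_comp (extendP v) (extendP u))).
Qed.

End Extension.

Section Localisation.
Variables (C : category) (W : morphism_class C) (L : category) (Q : functor C L).
Hypotheses (hW : homotopical W) (hQ : fraction_functor W Q).

(** [Q] is only essentially surjective, so an isomorphic copy in the image of
    [Q] is fixed for each object of [L]; functors out of [L] are computed on
    these copies. *)
Lemma model_exists (A : L) :
  {X : C & {e : Hom (Q X) A & {e' : Hom A (Q X) | e' \oc e = idc _ /\ e \oc e' = idc _}}}.
Proof.
have [X Xe] := cid (fraction_surj hQ A); have [e /cid[e' ee']] := cid Xe.
by exists X, e, e'.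
Qed.

Definition model A : C := projT1 (model_exists A).
Definition of_model A : Hom (Q (model A)) A := projT1 (projT2 (model_exists A)).
Definition to_model A : Hom A (Q (model A)) := sval (projT2 (projT2 (model_exists A))).

Lemma of_modelK A : to_model A \oc of_model A = idc _.
Proof. by case: (svalP (projT2 (projT2 (model_exists A)))). Qed.

Lemma to_modelK A : of_model A \oc to_model A = idc _.
Proof. by case: (svalP (projT2 (projT2 (model_exists A)))). Qed.

Lemma of_model_iso A : is_iso (of_model A).
Proof. by exists (to_model A); rewrite of_modelK to_modelK. Qed.

Section Factor.
Variables (D : category) (F : functor C D).
Hypothesis FW : inverts W F.

Let E := extend hW hQ FW.

Program Definition factor : functor L D :=
  @Functor L D (fun A => F (model A))
    (fun A B u => E (to_model B \oc u \oc of_model A)) _ _.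
Next Obligation. by rewrite compc1 of_modelK -(fmap1 Q) /E extend_fmap fmap1. Qed.
Next Obligation.
rewrite /E -extend_comp; congr extend.
by rewrite -!compA (compA (of_model _) (to_model _)) to_modelK comp1c.
Qed.

Program Definition factor_unit : nat_trans F (functor_comp factor Q) :=
  @NatTrans C D F (functor_comp factor Q) (fun X => E (to_model (Q X))) _.
Next Obligation.
rewrite -(extend_fmap hW hQ FW) /E -!extend_comp; congr extend.
by rewrite -!compA to_modelK compc1.
Qed.

Program Definition factor_counit : nat_trans (functor_comp factor Q) F :=
  @NatTrans C D (functor_comp factor Q) F (fun X => E (of_model (Q X))) _.
Next Obligation.
rewrite -(extend_fmap hW hQ FW) /E -!extend_comp; congr extend.
by rewrite !compA to_modelK comp1c.
Qed.

Lemma factor_iso : @isomorphic (functor_category C D) F (functor_comp factor Q).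
Proof.
exists factor_unit, factor_counit; split; apply: nat_trans_eq => X /=.
  by rewrite /E -extend_comp to_modelK -(fmap1 Q) extend_fmap fmap1.
by rewrite /E -extend_comp of_modelK -fmap1 extend_fmap fmap1.
Qed.

End Factor.

Section Extend_nat_trans.
Variables (D : category) (F G : functor L D).
Variable a : nat_trans (functor_comp F Q) (functor_comp G Q).

(** [a] again, with its type free of composed functors so that the lemmas about
    composition in [D] rewrite in it. *)
Definition component (X : C) : Hom (F (Q X)) (G (Q X)) := a X.

(** Naturality with respect to [C] propagates to fractions, because the
    denominators become epic. *)
Lemma component_natural (X Y : C) (u : Hom (Q X) (Q Y)) :
  component Y \oc fmap F u = fmap G u \oc component X.
Proof.
have [T [w [f [Ww uw]]]] := fraction_exists hQ u.
apply: (iso_epic (fmap_iso F (fraction_inverts hQ Ww))).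
rewrite -!compA -fmapM uw.
transitivity (fmap G (fmap Q f) \oc component T); first exact: (nt_nat a f).
rewrite -uw fmapM -compA; congr (_ \oc _).
exact: esym (nt_nat a w).
Qed.

Program Definition extend_nat_trans : nat_trans F G :=
  @NatTrans L D F G
    (fun A => fmap G (of_model A) \oc component (model A) \oc fmap F (to_model A)) _.
Next Obligation.
have uE : to_model Y \oc f = to_model Y \oc f \oc of_model X \oc to_model X.
  by rewrite -!compA to_modelK compc1.
have uE' : f \oc of_model X = of_model Y \oc (to_model Y \oc f \oc of_model X).
  by rewrite !compA to_modelK comp1c.
rewrite -compA -(fmapM F) uE (fmapM F) 2!(compA (fmap G f)) -(fmapM G) uE' (fmapM G).
by rewrite -!compA (compA (component _)) component_natural !compA.
Qed.

Lemma extend_nat_transE : nat_whisker Q extend_nat_trans = a.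
Proof.
apply: nat_trans_eq => X /=.
by rewrite -compA component_natural compA -fmapM to_modelK fmap1 comp1c.
Qed.

End Extend_nat_trans.

Theorem fraction_functor_localisation : localisation W Q.
Proof.
split.
- exact: fraction_inverts.
- by move=> D F FW; exists (factor FW); exact: factor_iso.
- by move=> D F G a; exists (extend_nat_trans a); exact: extend_nat_transE.
- move=> D F G a b ab; apply: nat_trans_eq => A.
  apply: (iso_epic (fmap_iso F (of_model_iso A))); rewrite !nt_nat; congr comp.
  exact: (congr1 (fun c : nat_trans _ _ => c (model A)) ab).
Qed.

End Localisation.

(** * Every localisation is a fraction functor *)

Lemma isomorphic_functor_iso (C D : category) (F G : functor C D) :
  @isomorphic (functor_category C D) F G ->
  exists a : nat_trans F G, forall X, is_iso (a X).
Proof.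
move=> [a [b [ba ab]]]; exists a => X; exists (b X).
by split; [have /(congr1 (fun c : nat_trans _ _ => c X)) := ba
          |have /(congr1 (fun c : nat_trans _ _ => c X)) := ab].
Qed.

Program Definition functor_id (C : category) : functor C C :=
  @Functor C C id (fun X Y => id) _ _.

(** Full faithfulness of the precomposition with [Q] lifts the isomorphism from
    [Q] to [M Q] to one from the identity to [M]. *)
Lemma localisation_retract (C : category) (W : morphism_class C) (L : category)
    (Q : functor C L) (M : functor L L) : localisation W Q ->
  @isomorphic (functor_category C L) Q (functor_comp M Q) ->
  exists a : nat_trans (functor_id L) M, forall A, is_iso (a A).
Proof.
move=> hQ [a [b [ba ab]]].
pose a' : nat_trans (functor_comp (functor_id L) Q) (functor_comp M Q) :=
  @NatTrans C L (functor_comp (functor_id L) Q) (functor_comp M Q) a (@nt_nat _ _ _ _ a).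
pose b' : nat_trans (functor_comp M Q) (functor_comp (functor_id L) Q) :=
  @NatTrans C L (functor_comp M Q) (functor_comp (functor_id L) Q) b (@nt_nat _ _ _ _ b).
have [c ca] := localisation_full hQ (a' : @Hom (functor_category C L)
  (precomposition L Q (functor_id L)) (precomposition L Q M)).
have [d db] := localisation_full hQ (b' : @Hom (functor_category C L)
  (precomposition L Q M) (precomposition L Q (functor_id L))).
have cE X : c (Q X) = a X by have /(congr1 (fun t : nat_trans _ _ => t X)) := ca.
have dE X : d (Q X) = b X by have /(congr1 (fun t : nat_trans _ _ => t X)) := db.
apply: isomorphic_functor_iso; exists c, d.
split; apply: (localisation_faithful hQ); apply: nat_trans_eq => X /=; rewrite cE dE.
  by have /(congr1 (fun t : nat_trans _ _ => t X)) := ba.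
by have /(congr1 (fun t : nat_trans _ _ => t X)) := ab.
Qed.

Lemma nat_trans_iso (C D : category) (F G : functor C D) (a : nat_trans F G) :
  (forall X, is_iso (a X)) -> @is_iso (functor_category C D) F G a.
Proof.
move=> ai; pose b X := sval (cid (ai X)).
have ba X : b X \oc a X = idc _ by have [] := svalP (cid (ai X)).
have ab X : a X \oc b X = idc _ by have [] := svalP (cid (ai X)).
have bN (X Y : C) (f : Hom X Y) : b Y \oc fmap G f = fmap F f \oc b X.
  apply: (iso_epic (ai X)); rewrite -compA -nt_nat compA ba comp1c.
  by rewrite -compA ba compc1.
by exists (NatTrans bN); split; apply: nat_trans_eq.
Qed.

Lemma isomorphic_comp_unit (C L0 L : category) (Q0 : functor C L0) (Q : functor C L)
    (F : functor L L0) (G : functor L0 L) :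
  @isomorphic (functor_category C L0) Q0 (functor_comp F Q) ->
  @isomorphic (functor_category C L) Q (functor_comp G Q0) ->
  @isomorphic (functor_category C L) Q (functor_comp (functor_comp G F) Q).
Proof.
move=> /isomorphic_functor_iso[a ai] /isomorphic_functor_iso[b bi].
have tN (X Y : C) (f : Hom X Y) : (fmap G (a Y) \oc b Y) \oc fmap Q f =
    fmap (functor_comp (functor_comp G F) Q) f \oc (fmap G (a X) \oc b X).
  rewrite -compA (nt_nat b f : b Y \oc fmap Q f = fmap G (fmap Q0 f) \oc b X) /= 2!compA -!fmapM.
  by rewrite (nt_nat a f : a Y \oc fmap Q0 f = fmap F (fmap Q f) \oc a X).
exists (@NatTrans C L Q (functor_comp (functor_comp G F) Q)
  (fun X => fmap G (a X) \oc b X) tN).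
by apply: nat_trans_iso => X; apply: iso_comp => //; exact: fmap_iso.
Qed.

(** Two localisations factor through each other by functors [F] and [G] with
    [G F] isomorphic to the identity.  Hence [F] is faithful, and the properties
    of [Q0] come back along it. *)
Theorem localisation_fraction_functor (C : category) (W : morphism_class C)
    (L0 : category) (Q0 : functor C L0) (L : category) (Q : functor C L) :
  fraction_functor W Q0 -> localisation W Q0 -> localisation W Q ->
  fraction_functor W Q.
Proof.
move=> fQ0 lQ0 lQ.
have [F FQ] := localisation_factor lQ (localisation_inverts lQ0).
have [G GQ0] := localisation_factor lQ0 (localisation_inverts lQ).
have [a ai] := isomorphic_functor_iso FQ.
have [b bi] := isomorphic_functor_iso GQ0.
have [c ci] : exists c : nat_trans (functor_id L) (functor_comp G F), forall A, is_iso (c A).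
  apply: localisation_retract lQ _.
  exact: isomorphic_comp_unit FQ GQ0.
have Ff : faithful F.
  move=> A B u v uv; apply: (iso_monic (ci B)).
  rewrite (nt_nat c u : c B \oc u = _) (nt_nat c v : c B \oc v = _) /=.
  by rewrite uv.
split.
- exact: localisation_inverts.
- move=> X Y f g fg; apply: (fraction_faithful fQ0).
  by apply: (iso_monic (ai Y)); rewrite !nt_nat /= fg.
- move=> A; have [X [e ei]] := fraction_surj fQ0 (F A).
  exists X; have [c' [cc' c'c]] := ci A.
  exists (c' \oc fmap G e \oc b X); apply: iso_comp => //.
  by apply: iso_comp; [exists (c A)|exact: fmap_iso].
- move=> X Y u; have [a' [aa' a'a]] := ai Y.
  have [T [w [f [Ww uw]]]] := fraction_exists fQ0 (a' \oc fmap F u \oc a X).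
  exists T, w, f; split=> //; apply: Ff; apply: (iso_epic (ai T)).
  rewrite fmapM -compA -(nt_nat a w : a X \oc fmap Q0 w = fmap F (fmap Q w) \oc a T).
  rewrite -(nt_nat a f : a Y \oc fmap Q0 f = fmap F (fmap Q f) \oc a T) -uw.
  by rewrite !compA a'a comp1c.
Qed.

(** * Exactness of fraction functors *)

Section Exactness.
Variables (C : category) (W : morphism_class C) (L : category) (Q : functor C L).
Hypotheses (W1 : forall X : C, W (idc X))
  (WM : forall (X Y Z : C) (g : Hom Y Z) (f : Hom X Y), W g -> W f -> W (g \oc f))
  (hQ : fraction_functor W Q).

(** Denominators are made common one at a time: a fraction representing the next
    morphism restricted to the denominator found so far refines it. *)
Lemma fractions_common (X : C) (I : Type) (Y : I -> C)
    (u : forall i, Hom (Q X) (Q (Y i))) : finite_type I ->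
  exists (T : C) (w : Hom T X), W w /\
    forall i, exists f : Hom T (Y i), u i \oc fmap Q w = fmap Q f.
Proof.
move=> [n [e e_surj]].
have [T [w [Ww wf]]] : exists (T : C) (w : Hom T X), W w /\ forall k, k \in enum 'I_n ->
    exists f : Hom T (Y (e k)), u (e k) \oc fmap Q w = fmap Q f.
  elim: (enum 'I_n) => [|k s [T [w [Ww wf]]]]; first by exists X, (idc X).
  have [T' [w' [f [Ww' uf]]]] := fraction_exists hQ (u (e k) \oc fmap Q w).
  exists T', (w \oc w'); split; first exact: WM.
  move=> j; rewrite inE => /predU1P[->|/wf[g ug]].
    by exists f; rewrite fmapM compA.
  by exists (g \oc w'); rewrite !fmapM compA ug.
exists T, w; split=> // i; have [k <-] := e_surj i.
by apply: wf; rewrite mem_enum.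
Qed.

(** A finite cone in the localisation becomes, after precomposition with a common
    denominator, the image of a cone of [C]: faithfulness makes the latter
    commute.  Thus the universal property is inherited from [C]. *)
Lemma fraction_functor_limit (J : category) (D : functor J C) (c : cone D) :
  finite_type J -> is_limit c -> is_limit (map_cone Q c).
Proof.
move=> Jfin clim c'.
have [X [e eiso]] := fraction_surj hQ (apex c').
have [e' [e'e ee']] := eiso.
have [T [w [Ww wf]]] := fractions_common (fun j => leg c' j \oc e) Jfin.
have Qw := fraction_inverts hQ Ww; have [v [vw wv]] := Qw.
have [f fE] : exists f : forall j, Hom T (D j),
    forall j, leg c' j \oc e \oc fmap Q w = fmap Q (f j).
  by exists (fun j => sval (cid (wf j))) => j; exact: svalP (cid (wf j)).
have fN (i j : J) (t : Hom i j) : fmap D t \oc f i = f j.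
  by apply: (fraction_faithful hQ); rewrite fmapM -!fE 2!compA (leg_nat c').
have [h [/= hE _]] := clim (Cone fN).
have lift (u : Hom (apex c') (Q (apex c))) :
    (forall j, fmap Q (leg c j) \oc u = leg c' j) <-> u \oc e \oc fmap Q w = fmap Q h.
  split=> [uE|uE j]; last first.
    apply: (iso_epic eiso); apply: (iso_epic Qw).
    by rewrite fE -hE fmapM -uE !compA.
  (* [u e w] need not come from [C], so the uniqueness in [C] is used after a
     further denominator *)
  have [T' [w' [k [Ww' kE]]]] := fraction_exists hQ (u \oc e \oc fmap Q w).
  apply: (iso_epic (fraction_inverts hQ Ww')); rewrite kE -fmapM; congr fmap.
  have fwN (i j : J) (t : Hom i j) : fmap D t \oc (f i \oc w') = f j \oc w'.
    by rewrite compA fN.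
  have [l [_ l_uniq]] := clim (Cone fwN).
  transitivity l; [apply: esym|]; apply: l_uniq => j /=; last by rewrite compA hE.
  apply: (fraction_faithful hQ); rewrite !fmapM -fE -kE -(uE j).
  by rewrite !compA.
exists (fmap Q h \oc v \oc e'); split=> [|u] /=.
  by apply/lift; rewrite -!compA (compA e') e'e comp1c vw compc1.
move/lift => uE; rewrite -uE.
by rewrite -!compA (compA (fmap Q w)) wv comp1c ee' compc1.
Qed.

End Exactness.

Program Definition opposite (C : category) : category :=
  @Category C (fun X Y => @Hom C Y X) (fun X => idc X) (fun X Y Z g f => f \oc g) _ _ _.
Next Obligation. exact: compc1. Qed.
Next Obligation. exact: comp1c. Qed.
Next Obligation. by rewrite compA. Qed.

Program Definition functor_op (C D : category) (F : functor C D) :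
    functor (opposite C) (opposite D) :=
  @Functor (opposite C) (opposite D) F (fun X Y f => fmap F (f : @Hom C Y X)) _ _.
Next Obligation. exact: fmap1. Qed.
Next Obligation. exact: fmapM. Qed.

Lemma opposite_iso (C : category) (X Y : C) (f : Hom X Y) :
  is_iso f -> @is_iso (opposite C) Y X f.
Proof. by move=> [g [gf fg]]; exists g. Qed.

Definition opposite_cocone (J C : category) (D : functor J C) (c : cocone D) :
    cone (functor_op D) :=
  @Cone (opposite J) (opposite C) (functor_op D) (coapex c) (coleg c)
    (fun i j u => coleg_nat c u).

Definition opposite_cone (J C : category) (D : functor J C) (c : cone (functor_op D)) :
    cocone D :=
  @Cocone J C D (apex c) (fun j => leg c j)
    (fun i j u => @leg_nat (opposite J) (opposite C) (functor_op D) c j i u).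

Lemma opposite_colimit (J C : category) (D : functor J C) (c : cocone D) :
  is_colimit c <-> is_limit (opposite_cocone c).
Proof.
split=> clim d; first exact: (clim (opposite_cone d)).
exact: (clim (opposite_cocone d)).
Qed.

Section RightExactness.
Variables (C : category) (W : morphism_class C) (L : category) (Q : functor C L).
Hypotheses (hW : homotopical W) (hQ : fraction_functor W Q).
Hypothesis left_ore : forall (X Y Z : C) (w : Hom Z X) (f : Hom Z Y), W w ->
  exists (T : C) (w' : Hom Y T) (f' : Hom X T), W w' /\ f' \oc w = w' \oc f.

(** The left Ore condition turns each right fraction into a left one, so the
    opposite functor is again a fraction functor and colimits are handled as
    limits in the opposite categories. *)
Lemma fraction_functor_op :
  @fraction_functor (opposite C) (fun X Y => @W Y X) (opposite L) (functor_op Q).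
Proof.
split=> [X Y w /(fraction_inverts hQ)/opposite_iso//|X Y f g|A|X Y u].
- exact: (fraction_faithful hQ).
- by have [X [e [e' [e'e ee']]]] := fraction_surj hQ A; exists X, e', e.
have [T [w [f [Ww uw]]]] := fraction_exists hQ (u : @Hom L (Q Y) (Q X)).
have [T' [w' [f' [Ww' wf]]]] := left_ore f Ww.
exists T', w', f'; split=> //; change (fmap Q w' \oc u = fmap Q f').
apply: (iso_epic (fraction_inverts hQ Ww)).
by rewrite -compA uw -!fmapM wf.
Qed.

Lemma fraction_functor_colimit (J : category) (D : functor J C) (c : cocone D) :
  finite_type J -> is_colimit c -> is_colimit (map_cocone Q c).
Proof.
move=> Jfin /opposite_colimit clim; apply: (proj2 (opposite_colimit (map_cocone Q c))) => d.
(* the two composites of opposite functors differ in their proofs of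
   functoriality, so the cone is repackaged *)
pose d' : cone (functor_comp (functor_op Q) (functor_op D)) :=
  @Cone (opposite J) (opposite L) (functor_comp (functor_op Q) (functor_op D))
    (apex d) (leg d) (@leg_nat _ _ _ d).
have W1 : forall X : opposite C, W (idc X : @Hom C X X).
  by move=> X; exact: (homotopical_id hW).
have WM : forall (X Y Z : opposite C) (g : Hom Y Z) (f : Hom X Y),
    @W Z Y g -> @W Y X f -> @W Z X (g \oc f).
  by move=> X Y Z g f Wg Wf; exact: (homotopical_comp hW).
exact (@fraction_functor_limit _ _ _ _ W1 WM fraction_functor_op (opposite J)
  (functor_op D) (opposite_cocone c) Jfin clim d').
Qed.

Theorem fraction_functor_exact : exact_functor Q.
Proof.
move=> J D [Jfin _]; split=> c; last exact: fraction_functor_colimit.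
exact: (fraction_functor_limit (homotopical_id hW) (homotopical_comp hW) hQ).
Qed.

End RightExactness.

(** * Groups generated by a finite normal set *)

Lemma size_count_sum (T : eqType) (s l : seq T) : uniq s -> {subset l <= s} ->
  size l = (\sum_(d <- s) count_mem d l)%N.
Proof.
move=> us; elim: l => [_|x l IHl sl] /=; first by rewrite big1.
rewrite big_split /= -IHl => [|y yl]; last by apply: sl; rewrite inE yl orbT.
suff -> : (\sum_(d <- s) (x == d))%N = 1%N by [].
rewrite (eq_bigr (fun d => if d == x then 1 else 0)%N) => [|d _]; last first.
  by rewrite eq_sym; case: eqP.
by rewrite -big_mkcond sum1_count count_uniq_mem // sl // mem_head.
Qed.

Section Words.
Variables (G : groupType) (D : set G).
Hypothesis D_conj : forall x g, D x -> D (x ^ g).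

Definition word (l : seq G) := forall x, x \in l -> D x.

Lemma word_cat l l' : word l -> word l' -> word (l ++ l').
Proof. by move=> wl wl' x; rewrite mem_cat => /orP[/wl|/wl']. Qed.

Lemma word_conj l g : word l -> word [seq x ^ g | x <- l].
Proof. by move=> wl _ /mapP[x /wl Dx ->]; exact: D_conj. Qed.

Lemma prod_conj (l : seq G) g :
  \prod_(x <- [seq x ^ g | x <- l]) x = (\prod_(x <- l) x) ^ g.
Proof. by rewrite big_map conjg_prod. Qed.

(** Moving an occurrence of [d] to the front conjugates the letters that it
    passes; they stay in [D], and those equal to [d] stay equal to [d]. *)
Lemma word_collect d n l : D d -> word l -> n <= count_mem d l ->
  exists l', [/\ word l', size l' + n = size l &
    \prod_(x <- l) x = d ^+ n * \prod_(x <- l') x].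
Proof.
move=> Dd; elim: n l => [|n IHn] l wl nl.
  by exists l; rewrite addn0 expg0 mul1g.
have dl : d \in l by rewrite -has_pred1 has_count (leq_trans _ nl).
case/splitPr: dl wl nl => l1 l2 wl; rewrite count_cat /= eqxx addnCA ltnS => nl.
have [||l' [wl' sl' pl']] := IHn ([seq x ^ d | x <- l1] ++ l2).
- apply: word_cat; last by move=> x xl2; apply: wl; rewrite mem_cat inE xl2 !orbT.
  by apply: word_conj => x xl1; apply: wl; rewrite mem_cat xl1.
- rewrite count_cat count_map; apply: leq_trans nl _; rewrite leq_add2r.
  by apply: sub_count => x /eqP -> /=; rewrite conjgE mulgA mulVg mul1g.
exists l'; split=> //.
  by rewrite addnS sl' !size_cat size_map addnS.
rewrite expgS -mulgA -pl' !big_cat big_cons /= prod_conj.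
by rewrite !mulgA mulgV mul1g.
Qed.

(** In a long word some letter [d] occurs often enough for its occurrences, once
    collected, to be replaced by a shorter word. *)
Lemma word_shorten : finite_set D ->
  (forall d, D d -> exists l, word l /\ d ^+ (size l).+1 = \prod_(x <- l) x) ->
  exists n, forall l, word l ->
    exists l', [/\ word l', size l' <= n & \prod_(x <- l) x = \prod_(x <- l') x].
Proof.
move=> /finite_seqP[s0 Ds] H.
pose s := undup s0; have us : uniq s by exact: undup_uniq.
have {}Ds x : D x <-> x \in s by rewrite mem_undup Ds.
have /choice[m mP] : forall d, exists k, D d ->
    exists l, [/\ word l, size l = k & d ^+ k.+1 = \prod_(x <- l) x].
  move=> d; have [/H[l [wl dl]]|nD] := pselect (D d); first by exists (size l) => _; exists l.
  by exists 0.
exists (\sum_(d <- s) m d)%N => l.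
have [k] := ubnP (size l); elim: k l => // k IHk l lk wl.
have [le|lt] := leqP (size l) (\sum_(d <- s) m d)%N; first by exists l.
have [d ds dl] : exists2 d, d \in s & m d < count_mem d l.
  apply: contrapT => nex; move: lt; rewrite ltnNge => /negP; apply.
  have -> : size l = (\sum_(d <- s) count_mem d l)%N.
    by apply: size_count_sum => // x /wl /Ds.
  rewrite big_seq [leqRHS]big_seq; apply: leq_sum => d ds.
  by rewrite leqNgt; apply/negP => lt; apply: nex; exists d.
have Dd := (Ds d).2 ds.
have [l1 [wl1 sl1 pl1]] := word_collect Dd wl dl.
have [l2 [wl2 sl2 pl2]] := mP _ Dd.
have [||l' [wl' sl' pl']] := IHk (l2 ++ l1); last 1 first.
- by exists l'; split=> //; rewrite pl1 pl2 -pl' big_cat.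
- by rewrite size_cat sl2 addnC; rewrite addnS in sl1; rewrite sl1.
- exact: word_cat.
Qed.

Lemma word_finite n : finite_set D ->
  finite_set [set y | exists l, [/\ word l, size l <= n & y = \prod_(x <- l) x]].
Proof.
move=> Dfin; elim: n => [|n IHn].
  apply: sub_finite_set (finite_set1 1) => y [[|x l] [_ // _ ->]].
  by rewrite /= big_nil.
have Wfin := finite_image2 (fun x y : G => x * y) Dfin IHn.
have {Wfin} : finite_set ([set 1] `|` [set x * y | x in D & y in
    [set y | exists l, [/\ word l, size l <= n & y = \prod_(x <- l) x]]]).
  by rewrite finite_setU; split=> //; exact: finite_set1.
apply: sub_finite_set => y [[|x l] [wl /= ln ->]]; first by left; rewrite big_nil.
right; exists x; first by apply: wl; rewrite mem_head.
exists (\prod_(x <- l) x); last by rewrite big_cons.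
by exists l; split=> // z zl; apply: wl; rewrite inE zl orbT.
Qed.

Lemma words_finite : finite_set D ->
  (forall d, D d -> exists l, word l /\ d ^+ (size l).+1 = \prod_(x <- l) x) ->
  finite_set [set \prod_(x <- l) x | l in word].
Proof.
move=> Dfin /(word_shorten Dfin)[n nP]; apply: sub_finite_set (word_finite n Dfin).
by move=> _ [l /nP[l' [wl' sl' ->]] <-]; exists l'.
Qed.

End Words.

Section FiniteConjugacy.
Variable G : groupType.
Hypothesis FC : forall x : G, finite_set [set x ^ g | g in [set: G]].

(** Powers of [c] conjugate [x] to finitely many elements only. *)
Lemma power_commute (c x : G) : exists n, commute (c ^+ n.+1) x.
Proof.
apply: contrapT => /forallNP nc.
suff /infiniteP : [set: nat] #<= [set x ^ g | g in [set: G]] by apply; exact: FC.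
have step i k : x ^ (c ^+ i) = x ^ (c ^+ (i + k)) -> k = 0.
  case: k => // k; rewrite addnC expgnDr conjgM => /conjg_inj xc; case: (nc k).
  by rewrite /commute [RHS]conjgC -xc.
apply: (@inj_card_leP _ _ _ _ (fun i => x ^ (c ^+ i))) => [i _|i j _ _].
  by exists (c ^+ i).
have [ij|ji] := leqP i j; first by rewrite -(subnKC ij) => /step ->; rewrite addn0.
by rewrite -(subnKC (ltnW ji)) => /esym/step ->; rewrite addn0.
Qed.

(** Rosenlicht's identity.  The commutator is the quotient of [g] by [g ^ h], and
    a power that commutes with [g ^ h] can be inserted between the two; this saves
    one factor when the power is rewritten as a product of commutators. *)
Lemma commutator_power (h g : G) n : commute ([~ h, g] ^+ n.+1) (g ^ h) ->
  [~ h, g] ^+ n.+2 = [~ h, g ^+ 2] * ([~ h, g] ^ g) ^+ n.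
Proof.
rewrite -conjXg (commgEr h (g ^+ 2)) conjVg conjXg.
have cE : [~ h, g] = (g ^ h)^-1 * g by rewrite commgEr conjVg.
rewrite cE; move: (g ^ h) => y cc.
rewrite expgSr mulgA (commuteV cc) expgS (conjgE _ g) !expg2 invgM.
by rewrite !mulgA mulgK.
Qed.

End FiniteConjugacy.

(** * Sets of cardinality below kappa *)

Section Small.
Variable kappa : Type.
Hypothesis kinf : infinite_set [set: kappa].

Definition small T (A : set T) : Prop := A #< [set: kappa].

Lemma small_le T U (A : set T) (B : set U) : A #<= B -> small B -> small A.
Proof. exact: card_le_lt_trans. Qed.

Lemma small_sub T (A B : set T) : A `<=` B -> small B -> small A.
Proof. by move=> /subset_card_le; exact: small_le. Qed.

Lemma small_image T U (f : T -> U) (A : set T) : small A -> small (f @` A).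
Proof. exact: small_le (card_image_le f A). Qed.

Lemma small_finite T (A : set T) : finite_set A -> small A.
Proof.
move=> Afin; rewrite /small card_ltNge; apply/negP => /card_le_finite kfin.
exact: kinf (kfin Afin).
Qed.

Lemma small_image2 T U V (f : T -> U -> V) (A : set T) (B : set U) :
  small A -> small B -> small [set f x y | x in A & y in B].
Proof.
move=> As Bs; apply: small_sub (small_image (fun p => f p.1 p.2) (card_lt_setX kinf As Bs)).
by move=> _ [x Ax [y By <-]]; exists (x, y).
Qed.

(** Finitely many elements may generate an infinite group, so smallness of
    generated subgroups has to be discussed separately when kappa is countable. *)
Lemma small_finite_or_nat :
  (forall T (A : set T), small A -> finite_set A) \/ small [set: nat].
Proof.
have [nk|kn] := boolP ([set: kappa] #<= [set: nat]); last first.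
  by right; rewrite /small card_ltNge.
left=> T A; rewrite /small card_ltNge => /negP Ak; apply: contrapT.
by move=> /infiniteP nA; apply: Ak; exact: card_le_trans nk nA.
Qed.

(** A list is encoded by its length and by an iterated pairing with values in
    the infinite small set [B]. *)
Lemma small_lists (T : eqType) (A : set T) : small [set: nat] -> small A ->
  small [set l : seq T | forall x, x \in l -> A x].
Proof.
move=> ns As; have [[a0 Aa0]|/nonemptyPn A0] := pselect (A !=set0); last first.
  apply: (@small_sub _ _ [set [::]]); last exact/small_finite/finite_set1.
  by move=> [//|x l] xA; have := xA x (mem_head _ _); rewrite A0.
pose B := [set: nat] `*` A.
have Bs : small B by exact: card_lt_setX.
have Binf : infinite_set B.
  apply/infiniteP; apply: (@inj_card_leP _ _ _ _ (fun n => (n, a0))) => //.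
  by move=> m n _ _ [].
have B0 : B !=set0 by exists (0, a0).
have [p [pB pinj]] := card_le_inj B0 (card_le_square Binf).
pose enc := foldr (fun x b => p ((0, x), b)) (0, a0).
have encB l : (forall x, x \in l -> A x) -> B (enc l).
  elim: l => [//|x l IHl] xA /=; apply: pB; split=> /=.
    by split=> //=; apply: xA; rewrite mem_head.
  by apply: IHl => y yl; apply: xA; rewrite inE yl orbT.
apply: small_le (card_lt_setX kinf ns Bs).
apply: (@inj_card_leP _ _ _ _ (fun l => (size l, enc l))); first by move=> l /encB.
elim=> [|x l IHl] [|y l'] //; try by move=> _ _ [].
move=> xA yA [ll'] /pinj H.
have xlA : forall z, z \in l -> A z by move=> z zl; apply: xA; rewrite inE zl orbT.
have ylA : forall z, z \in l' -> A z by move=> z zl; apply: yA; rewrite inE zl orbT.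
have Bcons z k : (forall t, t \in z :: k -> A t) -> (B `*` B) ((0, z), enc k).
  move=> zkA; split; first by split=> //=; apply: zkA; rewrite mem_head.
  by apply: encB => t tk; apply: zkA; rewrite inE tk orbT.
have [-> ee] := H (Bcons _ _ xA) (Bcons _ _ yA).
by rewrite (IHl l') // ll' ee.
Qed.

(** Applied to the entourage of all pairs [(g, g * k)], invariance bounds the
    number of conjugates of the elements of [K]. *)
Lemma uniformly_invariantP (G : groupType) :
  uniformly_invariant (@group_coarse kappa G) <->
  forall K : set G, small K -> small [set k ^ g | k in K & g in [set: G]].
Proof.
split=> [Ginv K Ks|Ginv E [K Ks EK]].
  have := Ginv [set (g, g * k) | g in [set: G] & k in K]; case; first by exists K.
  move=> K' Ks' EK'; apply: small_sub Ks' => _ [k Kk [g _ <-]].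
  have [|h _ [k' Kk' [hE kE]]] := EK' (1, k ^ g); last first.
    by move: kE; rewrite hE mul1g => <-.
  exists g => //; exists (1, k); first by exists 1 => //; exists k; rewrite ?mul1g.
  by rewrite /= mulg1 mulVg -mulgA.
exists [set k ^ g | k in K & g in [set: G]]; first exact: Ginv.
move=> _ [g _ [p /EK[h _ [k Kk <-]] <-]] /=.
exists (g^-1 * h * g) => //; exists (k ^ g); first by exists k => //; exists g.
by congr pair; rewrite conjgE !mulgA mulgK.
Qed.

Definition subgroup (G : groupType) (P : set G) :=
  [/\ P 1, forall x y, P x -> P y -> P (x * y) & forall x, P x -> P x^-1].

Definition normalised (G : groupType) (N P : set G) :=
  forall x g, N x -> P g -> N (x ^ g).

(** Every small set becomes central modulo a small normal subgroup, namely the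
    one generated by the commutators of its conjugates.  For uncountable kappa a
    group with few generators is small.  For countable kappa, [G] has finite
    conjugacy classes and the generated group is finite by the collection
    argument: Rosenlicht's identity provides the shortening of powers. *)
Lemma small_commutators (G : groupType) (S : set G) :
  uniformly_invariant (@group_coarse kappa G) -> small S ->
  exists M : set G, [/\ small M, subgroup M, normalised M [set: G] &
    forall s g, S s -> M [~ s, g]].
Proof.
move=> /uniformly_invariantP Ginv Ss.
pose H := [set s ^ g | s in S & g in [set: G]].
have Hs : small H by exact: Ginv.
have HJ h g : H h -> H (h ^ g).
  by move=> [s Ss' [x _ <-]]; exists s => //; exists (x * g); rewrite ?conjgM.
pose D := [set [~ h, g] | h in H & g in [set: G]].
have DJ x g : D x -> D (x ^ g).
  move=> [h Hh [y _ <-]]; exists (h ^ g); first exact: HJ.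
  by exists (y ^ g); rewrite ?conjRg.
have Ds : small D.
  apply: small_sub (small_image2 (fun x y => x^-1 * y) Hs Hs).
  by move=> _ [h Hh [g _ <-]]; exists h => //; exists (h ^ g); [exact: HJ|rewrite commgEl].
exists [set \prod_(x <- l) x | l in word D]; split.
- have [fin|ns] := small_finite_or_nat; last exact/small_image/small_lists.
  apply/small_finite/words_finite => //; first exact: fin.
  move=> _ [h Hh [g _ <-]].
  have [x|n cn] := @power_commute G _ [~ h, g] (g ^ h).
    apply: fin; apply: small_sub (Ginv _ (small_finite (finite_set1 x))).
    by move=> _ [y _ <-]; exists x => //; exists y.
  exists ([~ h, g ^+ 2] :: nseq n ([~ h, g] ^ g)); split.
    move=> y; rewrite inE => /predU1P[->|/nseqP[-> _]].
      by exists h => //; exists (g ^+ 2).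
    by apply: DJ; exists h => //; exists g.
  rewrite /= size_nseq commutator_power // big_cons; congr (_ * _).
  by elim: n {cn} => [|n IHn]; rewrite ?big_nil // big_cons -IHn expgS.
- split; first by exists [::] => //; rewrite big_nil.
    move=> _ _ [l wl <-] [l' wl' <-]; exists (l ++ l'); last by rewrite big_cat.
    exact: word_cat.
  move=> _ [l wl <-]; exists [seq x^-1 | x <- rev l].
    move=> _ /mapP[x + ->]; rewrite mem_rev => /wl[h Hh [g _ <-]].
    rewrite invgR; exists (h ^ g); first exact: HJ.
    by exists g^-1 => //; rewrite commgEl conjgK (commgEl g h) !conjgE !invgM invgK !mulgA.
  by rewrite big_map prodgV revK.
- move=> _ g [l wl <-] _; exists [seq x ^ g | x <- l]; last exact: prod_conj.
  exact: word_conj.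
- move=> s g Ss'; exists [:: [~ s, g]]; last by rewrite big_seq1.
  move=> x; rewrite inE => /eqP ->; exists s; last by exists g.
  by exists s => //; exists 1; rewrite ?conjg1.
Qed.

End Small.

(** * Subquotients of groups *)

(** Pullbacks, quotients and the extensions below all consist of the cosets of a
    subgroup [sec_bot] that meet a subgroup [sec_top] normalising it, so they are
    constructed together. *)
Record group_section (G : groupType) := GroupSection {
  sec_top : set G;
  sec_bot : set G;
  sec_topP : subgroup sec_top;
  sec_botP : subgroup sec_bot;
  sec_normal : normalised sec_bot sec_top
}.

Definition subquotient (G : groupType) (S : group_section G) : Type :=
  {A : set G | exists2 x, sec_top S x & A = [set y | sec_bot S (x^-1 * y)]}.

Section Subquotient.
Variables (G : groupType) (S : group_section G).
Local Notation P := (sec_top S).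
Local Notation N := (sec_bot S).

HB.instance Definition _ := gen_eqMixin (subquotient S).
HB.instance Definition _ := gen_choiceMixin (subquotient S).

Lemma sec_top1 : P 1. Proof. by case: (sec_topP S). Qed.
Lemma sec_topM x y : P x -> P y -> P (x * y). Proof. by case: (sec_topP S) => _ + _; exact. Qed.
Lemma sec_topV x : P x -> P x^-1. Proof. by case: (sec_topP S) => _ _; exact. Qed.
Lemma sec_bot1 : N 1. Proof. by case: (sec_botP S). Qed.
Lemma sec_botM x y : N x -> N y -> N (x * y). Proof. by case: (sec_botP S) => _ + _; exact. Qed.
Lemma sec_botV x : N x -> N x^-1. Proof. by case: (sec_botP S) => _ _; exact. Qed.

Lemma sq_inj : injective (sval : subquotient S -> set G).
Proof. by case=> A PA [B PB] /= AB; exact: eq_exist. Qed.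

Definition coset_in (x : G) (Px : P x) : subquotient S :=
  exist _ [set y | N (x^-1 * y)] (ex_intro2 _ _ x Px erefl).

(** Total, with the trivial class as the value outside the top group, so that
    it can be used as a map on [G]. *)
Definition sq_class (x : G) : subquotient S :=
  if pselect (P x) is left Px then coset_in Px else coset_in sec_top1.

Lemma sq_repr_subproof (A : subquotient S) : exists x, P x /\ sval A = [set y | N (x^-1 * y)].
Proof. by case: A => A [x Px AE]; exists x. Qed.

Definition sq_repr (A : subquotient S) : G := sval (cid (sq_repr_subproof A)).

Lemma sq_repr_top A : P (sq_repr A).
Proof. by rewrite /sq_repr; case: cid => x []. Qed.

Lemma val_sq_class x : P x -> sval (sq_class x) = [set y | N (x^-1 * y)].
Proof. by rewrite /sq_class; case: pselect. Qed.

Lemma sq_classP x y : P x -> P y -> sq_class x = sq_class y <-> N (x^-1 * y).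
Proof.
move=> Px Py; split=> [/(congr1 sval)|Nxy].
  rewrite !val_sq_class // => /seteqP[_ /(_ y)] /=; apply.
  by rewrite mulVg; exact: sec_bot1.
apply: sq_inj; rewrite !val_sq_class //; apply/seteqP; split=> z /=.
  have -> : y^-1 * z = (x^-1 * y)^-1 * (x^-1 * z) by rewrite invgM invgK !mulgA mulgK.
  by move=> Nz; apply: sec_botM => //; exact: sec_botV.
have -> : x^-1 * z = (x^-1 * y) * (y^-1 * z) by rewrite -!mulgA mulVKg.
exact: sec_botM.
Qed.

Lemma sq_reprK A : sq_class (sq_repr A) = A.
Proof.
apply: sq_inj; rewrite val_sq_class; last exact: sq_repr_top.
by rewrite /sq_repr; case: cid => x [].
Qed.

Lemma sq_repr_class x : P x -> N (x^-1 * sq_repr (sq_class x)).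
Proof. by move=> Px; apply/sq_classP; rewrite ?sq_reprK //; exact: sq_repr_top. Qed.

Definition sq_one := sq_class 1.
Definition sq_mul A B := sq_class (sq_repr A * sq_repr B).
Definition sq_inv A := sq_class (sq_repr A)^-1.

Lemma sq_mulE x y : P x -> P y -> sq_mul (sq_class x) (sq_class y) = sq_class (x * y).
Proof.
move=> Px Py; have [Rx Ry] := (sq_repr_top (sq_class x), sq_repr_top (sq_class y)).
apply/esym/sq_classP; [exact: sec_topM|exact: sec_topM|].
set x' := sq_repr _; set y' := sq_repr _.
have -> : (x * y)^-1 * (x' * y') = (x^-1 * x') ^ y * (y^-1 * y').
  by rewrite conjgE invgM !mulgA mulgK.
by apply: sec_botM; [apply: sec_normal => //; exact: sq_repr_class|exact: sq_repr_class].
Qed.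

Lemma sq_invE x : P x -> sq_inv (sq_class x) = sq_class x^-1.
Proof.
move=> Px; have Rx := sq_repr_top (sq_class x).
apply/esym/sq_classP; [exact: sec_topV|exact: sec_topV|].
set x' := sq_repr _.
have -> : x^-1^-1 * x'^-1 = ((x^-1 * x') ^ x^-1)^-1.
  by rewrite conjgE !invgM !invgK !mulgA mulgK.
by apply: sec_botV; apply: sec_normal; [exact: sq_repr_class|exact: sec_topV].
Qed.

Lemma sq_mulA : associative sq_mul.
Proof.
move=> A B C; rewrite -(sq_reprK A) -(sq_reprK B) -(sq_reprK C).
by rewrite !sq_mulE ?mulgA //; do ?[exact: sq_repr_top|apply: sec_topM].
Qed.

Lemma sq_mul1 : left_id sq_one sq_mul.
Proof.
move=> A; rewrite -(sq_reprK A) /sq_one sq_mulE ?mul1g //; last exact: sq_repr_top.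
exact: sec_top1.
Qed.

Lemma sq_1mul : right_id sq_one sq_mul.
Proof.
move=> A; rewrite -(sq_reprK A) /sq_one sq_mulE ?mulg1 //; last exact: sec_top1.
exact: sq_repr_top.
Qed.

Lemma sq_mulV : left_inverse sq_one sq_inv sq_mul.
Proof.
move=> A; rewrite -(sq_reprK A); have PA := sq_repr_top A.
by rewrite sq_invE // sq_mulE ?mulVg //; exact: sec_topV.
Qed.

Lemma sq_Vmul : right_inverse sq_one sq_inv sq_mul.
Proof.
move=> A; rewrite -(sq_reprK A); have PA := sq_repr_top A.
by rewrite sq_invE // sq_mulE ?mulgV //; exact: sec_topV.
Qed.

HB.instance Definition _ := isGroup.Build (subquotient S) sq_mulA sq_mul1 sq_1mul sq_mulV sq_Vmul.

Lemma sq_classM x y : P x -> P y -> sq_class (x * y) = sq_class x * sq_class y.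
Proof. by move=> Px Py; rewrite -sq_mulE. Qed.

Lemma sq_classV x : P x -> sq_class x^-1 = (sq_class x)^-1.
Proof. by move=> Px; rewrite -sq_invE. Qed.

Lemma sq_class_eq1 x : P x -> sq_class x = 1 <-> N x.
Proof.
move=> Px; rewrite -[1]/(sq_class 1); split=> [/esym/sq_classP|Nx].
  by rewrite invg1 mul1g; apply=> //; exact: sec_top1.
by apply/esym/sq_classP; rewrite ?invg1 ?mul1g //; exact: sec_top1.
Qed.

End Subquotient.

(** * Homomorphisms and coarse equivalences *)

Section GroupMorphisms.
Variables (G H : groupType) (f : {multiplicative G -> H}).

Lemma hom1 : f 1 = 1.
Proof. by apply: (mulgI (f 1)); rewrite -gmulfM !mulg1. Qed.

Lemma homV x : f x^-1 = (f x)^-1.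
Proof. by apply: (mulgI (f x)); rewrite -gmulfM !mulgV hom1. Qed.

Lemma homJ x y : f (x ^ y) = f x ^ f y.
Proof. by rewrite !gmulfM homV. Qed.

Lemma homR x y : f [~ x, y] = [~ f x, f y].
Proof. by rewrite gmulfM homV homJ. Qed.

End GroupMorphisms.

Section Objects.
Variable kappa : Type.
Hypothesis kinf : infinite_set [set: kappa].
Local Notation small := (@small kappa _).
Local Notation coarse G := (@group_coarse kappa G).

Lemma subquotient_invariant (G : groupType) (S : group_section G) :
  uniformly_invariant (coarse G) -> uniformly_invariant (coarse (subquotient S)).
Proof.
move=> /uniformly_invariantP Ginv; apply/uniformly_invariantP => K Ks.
have Rs := small_image (@sq_repr _ S) Ks.
apply: small_sub (small_image (@sq_class _ S) (Ginv _ Rs)).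
move=> _ [A KA [B _ <-]]; exists (sq_repr A ^ sq_repr B).
  by exists (sq_repr A); [exists A|exists (sq_repr B)].
have [PA PB] := (sq_repr_top A, sq_repr_top B).
rewrite conjgE !sq_classM ?sq_classV ?sq_reprK //; first exact: sec_topV.
exact: sec_topM.
Qed.

Lemma prod_invariant (G H : groupType) : uniformly_invariant (coarse G) ->
  uniformly_invariant (coarse H) -> uniformly_invariant (coarse (G * H)%type).
Proof.
move=> /uniformly_invariantP Ginv /uniformly_invariantP Hinv.
apply/uniformly_invariantP => K Ks.
have K1 := Ginv _ (small_image fst Ks); have K2 := Hinv _ (small_image snd Ks).
apply: small_sub (card_lt_setX kinf K1 K2).
move=> _ [[x y] Kxy [[g h] _ <-]]; split=> /=.
  by exists x; [exists (x, y)|exists g].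
by exists y; [exists (x, y)|exists h].
Qed.

Definition subquotient_cgrp (G : groupType) (Ginv : uniformly_invariant (coarse G))
  (S : group_section G) : cgrp kappa := CGrpObj (@subquotient_invariant G S Ginv).

Lemma morph_bornologous (G H : groupType) (f : G -> H) : {morph f : x y / x * y} ->
  bornologous (coarse G) (coarse H) f.
Proof.
move=> fM E [K Ks EK]; exists (f @` K); first exact: small_image.
move=> _ [p /EK[g _ [k Kk <-]] <-]; exists (f g) => //.
by exists (f k); [exists k|rewrite /= fM].
Qed.

Definition morph_hom (G H : cgrp kappa) (f : G -> H) (fM : {morph f : x y / x * y}) :
    cgrp_hom G H :=
  @CGrpHom kappa G H (HB.pack_for {multiplicative G -> H} f (isMultiplicative.Build G H f fM))
    (morph_bornologous fM).

Lemma small_preimage (G H : groupType) (w : {multiplicative G -> H}) (K : set H) :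
  small [set x | w x = 1] -> small K -> small (w @^-1` K).
Proof.
move=> ker_s Ks.
have /choice[s sP] : forall k, exists x, (exists y, w y = k) -> w x = k.
  move=> k; have [[y yk]|ny] := pselect (exists y, w y = k); first by exists y.
  by exists 1 => /ny.
apply: small_sub (small_image2 kinf (fun k n => s k * n) Ks ker_s).
move=> x Kwx; exists (w x) => //; exists ((s (w x))^-1 * x); last by rewrite mulVKg.
by rewrite /= gmulfM homV sP ?mulVg //; exists x.
Qed.

(** A homomorphism is a coarse equivalence when its kernel is small and its image
    has few cosets: choosing, for each [y], some [g y] whose image lies in the
    coset of [y] gives a coarse inverse. *)
Lemma coarse_equivalenceP (G H : cgrp kappa) (w : cgrp_hom G H) :
  coarse_equivalence (coarse G) (coarse H) w <->
  small [set x | w x = 1] /\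
  exists2 K : set H, small K & forall y, exists x, K ((w x)^-1 * y).
Proof.
split=> [[_ [g [_ /group_closeP gw /group_closeP wg]]]|[ker_s [K Ks wK]]].
  split; last by eexists; first exact: wg; move=> y; exists (g y), y.
  apply: small_sub (small_image (fun x => g 1 * x) gw) => x wx.
  by exists ((g 1)^-1 * x); [exists x; rewrite //= wx|rewrite mulVKg].
have /choice[g gK] := wK.
split; first exact: cgrp_bornologous.
exists g; split.
- move=> E [L Ls EL].
  pose K' := [set k * l | k in K & l in L].
  have Ks' : small [set x * k^-1 | x in K' & k in K].
    by apply: small_image2 => //; exact: small_image2.
  exists (w @^-1` [set x * k^-1 | x in K' & k in K]); first exact: small_preimage.
  move=> _ [p /EL[y _ [l Ll <-]] <-] /=; exists (g y) => //.
  exists ((g y)^-1 * g (y * l)); last by rewrite mulVKg.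
  rewrite /= gmulfM homV; exists ((w (g y))^-1 * y * l).
    by exists ((w (g y))^-1 * y); [exact: gK|exists l].
  exists ((w (g (y * l)))^-1 * (y * l)); first exact: gK.
  by rewrite invgM invgK !mulgA -(mulgA _ y l) mulgK.
- apply/group_closeP; apply: (small_sub _ (small_preimage ker_s Ks)).
  by move=> _ [x _ <-] /=; rewrite gmulfM homV; exact: gK.
- by apply/group_closeP; apply: small_sub Ks => _ [y _ <-]; exact: gK.
Qed.

End Objects.

(** * Completing a span when the cosets have central representatives *)

Section CentralExtension.
Variable kappa : Type.
Hypothesis kinf : infinite_set [set: kappa].
Local Notation small := (@small kappa _).
Local Notation coarse G := (@group_coarse kappa G).

(** [xget] depends on [A x] only, and [A x] only on the coset of [x]; hence the
    choice is constant on cosets. *)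
Lemma transversal (G H : groupType) (w : {multiplicative G -> H}) (K : set H) :
  (forall x, exists z, K ((w z)^-1 * x)) ->
  exists r : H -> H, [/\ forall x, K (r x), forall x, exists z, x = w z * r x &
    forall z x, r (w z * x) = r x].
Proof.
move=> wK; pose A x := [set k | K k /\ exists z, x = w z * k].
have A0 x : A x !=set0.
  have [z Kz] := wK x; exists ((w z)^-1 * x); split=> //.
  by exists z; rewrite mulVKg.
exists (fun x => xget 1 (A x)).
split=> [x|x|z x]; try by have [] := xgetPex 1 (A0 x).
congr xget; apply/seteqP; split=> k [Kk [z' zk]]; split=> //.
  by exists (z^-1 * z'); rewrite gmulfM homV -mulgA -zk mulKg.
by exists (z * z'); rewrite gmulfM -mulgA -zk.
Qed.

(** Here [X] is the product of the image of [w] with a small central set [K] that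
    contains representatives [r] of the cosets of that image, and [f] sends
    into the centre of [Y] the elements of [Z] measuring the failure of [r] to
    be multiplicative.  The span formed by [w] and [f] is completed by the
    central product of [Y] with a central subgroup of [X] containing the
    representatives, amalgamated along the part of [Z] common to both. *)
Variables (Z X Y : cgrp kappa) (w : cgrp_hom Z X) (f : cgrp_hom Z Y).
Variables (K : set X) (r : X -> X).
Hypotheses (ker_small : small [set z | w z = 1]) (K_small : small K).
Hypothesis K_central : forall k x, K k -> commute k x.
Hypotheses (rK : forall x, K (r x)) (r_coset : forall x, exists z, x = w z * r x)
  (r_const : forall z x, r (w z * x) = r x).

Definition central_image (z : Z) := forall y, commute (f z) y.

Hypothesis cocycle_central : forall z k k', K k -> K k' ->
  w z * r (k * k') = k * k' -> central_image z.

Lemma central_image1 : central_image 1.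
Proof. by move=> y; rewrite hom1; apply: commute_sym; exact: commute1. Qed.

Lemma central_imageM a b : central_image a -> central_image b -> central_image (a * b).
Proof.
move=> ca cb y; rewrite gmulfM; apply: commute_sym.
by apply: commuteM; apply: commute_sym.
Qed.

Lemma central_imageV a : central_image a -> central_image a^-1.
Proof.
by move=> ca y; rewrite homV; apply: commute_sym; apply: commuteV; apply: commute_sym.
Qed.

Lemma r_central x y : r x * y = y * r x.
Proof. exact: K_central. Qed.

Lemma r_idem x : r (r x) = r x.
Proof. by have [z xE] := r_coset x; rewrite [in RHS]xE r_const. Qed.

(** The cocycle of a pair determines its preimage under [w] up to the kernel
    only, so the hypothesis on cocycles already covers the kernel. *)
Lemma central_image_ker a : w a = 1 -> central_image a.
Proof.
move=> wa; have [z zE] := r_coset (r 1 * r 1).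
rewrite -[a](mulgK z); apply: central_imageM; last apply: central_imageV.
all: apply: cocycle_central (rK 1) (rK 1) _.
  by rewrite gmulfM wa mul1g -zE.
by rewrite -zE.
Qed.

Lemma central_image_eq a b : w a = w b -> central_image a -> central_image b.
Proof.
move=> wab ca; rewrite -[b](mulVKg a); apply: central_imageM => //.
by apply: central_image_ker; rewrite gmulfM homV wab mulVg.
Qed.

Lemma r1_image : exists2 z, central_image z & w z = r 1.
Proof.
have [z zE] := r_coset 1; exists z^-1; last first.
  by rewrite homV; apply: mulg1_eq; rewrite -zE.
have wz : w z^-1 = r 1 by rewrite homV; apply: mulg1_eq; rewrite -zE.
apply: cocycle_central (rK 1) (rK 1) _.
have -> : r (r 1 * r 1) = r 1 by rewrite -{1}wz r_const r_idem.
by rewrite wz.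
Qed.

(** An explicit description of a central subgroup containing the representatives,
    chosen such that its intersection with the image of [w] comes from elements
    of [Z] with central image in [Y]. *)
Definition supplement (x : X) :=
  (forall y, commute x y) /\ exists2 a, central_image a & x = w a * r x.

Lemma supplement_r x : supplement (r x).
Proof.
split=> [y|]; first exact: r_central.
by exists 1; rewrite ?hom1 ?mul1g ?r_idem //; exact: central_image1.
Qed.

Lemma supplementM x y : supplement x -> supplement y -> supplement (x * y).
Proof.
move=> [cx [a ca xE]] [cy [b cb yE]]; split.
  by move=> z; apply: commute_sym; apply: commuteM; apply: commute_sym.
have [c cE] := r_coset (r x * r y).
have cc : central_image c by apply: cocycle_central (rK x) (rK y) _; rewrite -cE.
have xyE : x * y = w (a * b) * (r x * r y).
  rewrite [in LHS]xE [in LHS]yE gmulfM !mulgA -(mulgA (w a) (r x)) (r_central x (w b)).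
  by rewrite !mulgA.
exists (a * b * c); first by apply: central_imageM => //; exact: central_imageM.
by rewrite gmulfM {2}xyE r_const -mulgA -cE.
Qed.

(** This is the reason for [central_image] in [supplement]: it makes the
    amalgamated subgroup central. *)
Lemma supplement_image b : supplement (w b) -> central_image b.
Proof.
move=> [_ [a ca]]; rewrite -{2}[w b]mulg1 r_const; have [z cz <-] := r1_image.
by rewrite -gmulfM => /esym/central_image_eq; apply; exact: central_imageM.
Qed.

Lemma supplement_of_image a : (forall y, commute (w a) y) -> central_image a -> supplement (w a).
Proof.
move=> cwa ca; split=> //; have [z cz zE] := r1_image.
exists (a * z^-1); first by apply: central_imageM => //; exact: central_imageV.
by rewrite -{2}[w a]mulg1 r_const -zE -gmulfM mulgVK.
Qed.

Lemma supplement1 : supplement 1.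
Proof.
rewrite -(hom1 w); apply: supplement_of_image central_image1 => y; rewrite hom1.
by apply: commute_sym; exact: commute1.
Qed.

Lemma supplementV x : supplement x -> supplement x^-1.
Proof.
move=> [cx [a ca xE]].
have cxV y : commute x^-1 y by apply: commute_sym; apply: commuteV; exact: commute_sym.
split=> //; have [b bE] := r_coset x^-1.
exists b => //; rewrite -[b](mulKg a); apply: central_imageM; first exact: central_imageV.
have cE : w (a * b) * (r x * r x^-1) = 1.
  rewrite gmulfM -mulgA (mulgA (w b)) -(r_central x (w b)) !mulgA -xE -mulgA -bE.
  by rewrite mulgV.
have [c cE'] := r_coset (r x * r x^-1).
have cc : central_image c by apply: cocycle_central (rK x) (rK x^-1) _; rewrite -cE'.
have [z cz zE] := r1_image.
have rE : r (r x * r x^-1) = w z by rewrite zE -cE r_const.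
have : w (a * b * c * z) = 1 by rewrite 2!gmulfM -rE -mulgA -cE'.
move=> /central_image_ker cabcz; rewrite -[a * b](mulgK c) -[a * b * c](mulgK z).
apply: central_imageM; last exact: central_imageV.
by apply: central_imageM => //; exact: central_imageV.
Qed.

(** The relations identifying [f a] with [w a]. *)
Definition extension_graph : set (Y * X) :=
  [set p | exists2 a, supplement (w a) & p = (f a, (w a)^-1)].

Definition extension_top : set (Y * X) := [set p | supplement p.2].

Lemma extension_top_subgroup : subgroup extension_top.
Proof.
split=> [|[y x] [y' x']|[y x]]; first exact: supplement1.
  exact: supplementM.
exact: supplementV.
Qed.

Lemma supplement_commute x y : supplement x -> commute x y.
Proof. by case=> + _; apply. Qed.

Lemma extension_graph_subgroup : subgroup extension_graph.
Proof.
split=> [|_ _ [a La ->] [b Lb ->]|_ [a La ->]].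
- by exists 1; rewrite !hom1 ?invg1 //; exact: supplement1.
- exists (a * b); first by rewrite gmulfM; exact: supplementM.
  congr pair => /=; first by rewrite gmulfM.
  by rewrite -invgM gmulfM (supplement_commute (w b) La).
- exists a^-1; first by rewrite homV; exact: supplementV.
  by congr pair; rewrite ?homV.
Qed.

Lemma commute_conj (G : groupType) (x y : G) : commute x y -> x ^ y = x.
Proof. by move=> xy; rewrite conjgE xy mulKg. Qed.

Lemma extension_graph_normal : normalised extension_graph extension_top.
Proof.
move=> _ [y x] [a La ->] _; exists a => //.
congr pair => /=; apply: commute_conj; first exact: (supplement_image La).
exact/supplement_commute/supplementV.
Qed.

Definition extension_section : group_section (Y * X)%type :=
  GroupSection extension_top_subgroup extension_graph_subgroup extension_graph_normal.

Definition extension : cgrp kappa :=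
  subquotient_cgrp (prod_invariant kinf (@cgrp_invariant _ Y) (@cgrp_invariant _ X))
    extension_section.

Let cls (p : Y * X) : extension := sq_class extension_section p.

Definition extension_in (y : Y) : extension := cls (y, 1).

Lemma extension_inM : {morph extension_in : y y' / y * y'}.
Proof.
move=> y y'; rewrite /extension_in /cls -sq_classM; try exact: supplement1.
by congr sq_class; congr pair; rewrite /= mulg1.
Qed.

(** The kernel is the image under [f] of the kernel of [w], and the representatives
    [r x] give all cosets. *)
Lemma extension_in_equivalence :
  coarse_equivalence (coarse Y) (coarse extension) (morph_hom extension_inM).
Proof.
apply/coarse_equivalenceP; first exact: kinf; split.
  apply: small_sub (small_image f ker_small) => y.
  move=> /sq_class_eq1[|a La [-> wa]]; first exact: supplement1.
  by exists a => //=; rewrite -[w a]invgK -wa invg1.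
exists (cls @` [set (1, k) | k in K]); first exact/small_image/small_image.
move=> t; have [[y x] Lx <-] : exists2 p, extension_top p & cls p = t.
  exists (sq_repr (t : subquotient extension_section)).
    exact: (@sq_repr_top _ extension_section).
  exact: sq_reprK.
have [_ [a ca xE]] := (Lx : supplement x).
have La : supplement (w a).
  have -> : w a = x * (r x)^-1 by rewrite [X in X / _]xE mulgK.
  by apply: supplementM => //; apply: supplementV; exact: supplement_r.
exists (y * f a), (1, r x); first by exists (r x).
rewrite /= /extension_in -sq_classV; last exact: supplement1.
rewrite /cls -sq_classM //; last by apply: (supplementV supplement1).
apply/sq_classP; first exact: supplement_r.
  by apply: (supplementM (supplementV supplement1)).
exists a^-1; first by rewrite homV; exact: supplementV.
congr pair => /=; first by rewrite invg1 mul1g invgM -mulgA mulVg mulg1 homV.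
by rewrite invg1 mul1g homV invgK {2}xE (supplement_commute _ La) mulKg.
Qed.

Definition image_part (x : X) : Z := sval (cid (r_coset x)).

Lemma image_partE x : x = w (image_part x) * r x.
Proof. by rewrite /image_part; case: cid. Qed.

Definition extension_map (x : X) : extension := cls (f (image_part x), r x).

Lemma extension_mapM : {morph extension_map : x y / x * y}.
Proof.
move=> x y; rewrite /extension_map /cls -sq_classM; try exact: supplement_r.
apply/sq_classP; [exact: supplement_r|apply: supplementM; exact: supplement_r|].
set a := image_part x; set b := image_part y; set c := image_part (x * y).
have wE : w (c^-1 * (a * b)) = ((r (x * y))^-1 * (r x * r y))^-1.
  have imE t : w (image_part t) = t * (r t)^-1 by rewrite [X in X / _]image_partE mulgK.
  have rV : (r x)^-1 * y = y * (r x)^-1 by apply/esym/commuteV/esym; exact: r_central.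
  rewrite !gmulfM homV !imE [RHS]invgM invgK -(r_central (x * y)).
  rewrite (r_central x (r y)) [in RHS]invgM [in LHS]invgM invgK -!mulgA; congr (_ * _).
  by rewrite invgM (mulgA (r x)^-1 y) rV -!mulgA mulKg mulKg.
exists (c^-1 * (a * b)).
  rewrite wE; apply: supplementV; apply: supplementM; first apply: supplementV.
    exact: supplement_r.
  by apply: supplementM; exact: supplement_r.
by rewrite wE invgK; congr pair => /=; rewrite !gmulfM homV.
Qed.

Lemma extension_square z : extension_map (w z) = extension_in (f z).
Proof.
apply/esym/sq_classP; [exact: supplement1|exact: supplement_r|].
have wE : w (z^-1 * image_part (w z)) = (r (w z))^-1.
  by rewrite gmulfM homV {1}(image_partE (w z)) invgM mulgVK.
exists (z^-1 * image_part (w z)).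
  by rewrite wE; apply: supplementV; exact: supplement_r.
by rewrite wE invgK; congr pair; rewrite /= ?gmulfM ?homV // invg1 mul1g.
Qed.

End CentralExtension.

(** * Closeness, coarse equivalences and pullbacks *)

Section Equivalences.
Variable kappa : Type.
Hypothesis kinf : infinite_set [set: kappa].
Local Notation small := (@small kappa _).
Local Notation coarse G := (@group_coarse kappa G).
Local Notation cequiv w := (coarse_equivalence (coarse _) (coarse _) w).

Lemma close_refl (T : Type) (G : groupType) (f : T -> G) : close (coarse G) f f.
Proof.
apply/group_closeP; apply: (small_sub _ (small_finite kinf (finite_set1 1))).
by move=> _ [x _ <-]; rewrite mulVg.
Qed.

Lemma close_sym (T : Type) (G : groupType) (f g : T -> G) :
  close (coarse G) f g -> close (coarse G) g f.
Proof.
move=> /group_closeP fg; apply/group_closeP.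
apply: small_sub (small_image (fun x => x^-1) fg) => _ [x _ <-].
by exists ((f x)^-1 * g x); [exists x|rewrite invgM invgK].
Qed.

Lemma close_comp_r (T U : Type) (G : groupType) (f g : U -> G) (h : T -> U) :
  close (coarse G) f g -> close (coarse G) (f \o h) (g \o h).
Proof.
move=> /group_closeP fg; apply/group_closeP; apply: small_sub fg.
by move=> _ [x _ <-]; exists (h x).
Qed.

Lemma close_comp_l (T : Type) (G H : groupType) (f g : T -> G) (h : G -> H) :
  bornologous (coarse G) (coarse H) h -> close (coarse G) f g ->
  close (coarse H) (h \o f) (h \o g).
Proof. by move=> hb /hb; rewrite image_comp. Qed.

Lemma equivalence_id (G : cgrp kappa) : cequiv (cgrp_id G).
Proof.
split; first exact: cgrp_id_bornologous.
by exists idfun; split; [exact: cgrp_id_bornologous| |]; exact: close_refl.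
Qed.

Lemma equivalence_comp (G H L : cgrp kappa) (v : cgrp_hom H L) (w : cgrp_hom G H) :
  cequiv v -> cequiv w -> cequiv (cgrp_comp v w).
Proof.
move=> /(coarse_equivalenceP kinf)[kv [Kv Kvs vK]] /(coarse_equivalenceP kinf)[kw [Kw Kws wK]].
apply/(coarse_equivalenceP kinf); split; first exact: (small_preimage kinf kw kv).
exists [set v x * y | x in Kw & y in Kv]; first exact: small_image2.
move=> y; have [z Kvz] := vK y; have [x Kwx] := wK z; exists x.
exists ((w x)^-1 * z) => //; exists ((v z)^-1 * y) => //.
by rewrite /= gmulfM homV -mulgA mulVKg.
Qed.

Lemma equivalence_close (G H : cgrp kappa) (v w : cgrp_hom G H) :
  close (coarse H) v w -> cequiv v -> cequiv w.
Proof.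
move=> vw [_ [g [gb gv vg]]]; split; first exact: cgrp_bornologous.
have wv := close_sym vw.
exists g; split=> //; apply: group_close_trans => //; [|exact: gv| |exact: vg] => //.
  exact: (close_comp_l gb wv).
exact: (close_comp_r g wv).
Qed.

(** The small sets witnessing that [f] and [h] are equivalences are obtained by
    pulling back along [g] and [h g], whose kernels are small. *)
Lemma equivalence_2of6 (X Y Z T : cgrp kappa) (f : cgrp_hom X Y) (g : cgrp_hom Y Z)
    (h : cgrp_hom Z T) : cequiv (cgrp_comp g f) -> cequiv (cgrp_comp h g) ->
  [/\ cequiv f, cequiv g & cequiv h].
Proof.
move=> /(coarse_equivalenceP kinf)[kgf [K Ks gfK]] /(coarse_equivalenceP kinf)[khg [L Ls hgL]].
have kg : small [set y | g y = 1].
  by apply: small_sub khg => y /= ->; exact: hom1.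
split; apply/(coarse_equivalenceP kinf); split=> //.
- by apply: small_sub kgf => y /= ->; exact: hom1.
- exists (g @^-1` K); first exact: small_preimage.
  by move=> y; have [x Kx] := gfK (g y); exists x; rewrite /= gmulfM homV.
- by exists K => // z; have [x Kx] := gfK z; exists (f x).
- have hKs : small (h @` K) by exact: small_image.
  have hKVs : small ((fun x => x^-1) @` (h @` K)) by exact: small_image.
  apply: small_sub (small_image2 kinf (fun y k => g y * k) (small_preimage kinf khg hKVs) Ks).
  move=> z /= hz; have [x Kx] := gfK z.
  exists (f x); last by exists ((g (f x))^-1 * z); rewrite ?mulVKg.
  exists (h ((g (f x))^-1 * z)); first by exists ((g (f x))^-1 * z).
  by rewrite /= gmulfM hz mulg1 homV invgK.
- by exists L => // t; have [y Ly] := hgL t; exists (g y).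
Qed.

(** Preimages of small sets under [w] are small. *)
Lemma equivalence_monic (T : Type) (Y Z : cgrp kappa) (w : cgrp_hom Y Z) (f g : T -> Y) :
  cequiv w -> close (coarse Z) (w \o f) (w \o g) -> close (coarse Y) f g.
Proof.
move=> /(coarse_equivalenceP kinf)[kw _] /group_closeP wfg; apply/group_closeP.
apply: small_sub (small_preimage kinf kw wfg) => _ [x _ <-]; exists x => //.
by rewrite /= gmulfM homV.
Qed.

Section Pullback.
Variables (X Y Z : cgrp kappa) (w : cgrp_hom X Z) (f : cgrp_hom Y Z).

Lemma trivial_subgroup (G : groupType) : subgroup [set 1 : G].
Proof. by split=> [//|x y -> ->|x ->] /=; rewrite ?mulg1 ?invg1. Qed.

Definition pullback_top : set (X * Y) := [set p | w p.1 = f p.2].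

Lemma pullback_subgroup : subgroup pullback_top.
Proof.
split=> [|[x y] [x' y']|[x y]]; rewrite /pullback_top /=; first by rewrite !hom1.
  by rewrite !gmulfM => -> ->.
by rewrite !homV => ->.
Qed.

Lemma trivial_normal (G : groupType) (P : set G) : normalised [set 1] P.
Proof. by move=> _ g -> _; exact: conj1g. Qed.

Definition pullback_section : group_section (X * Y)%type :=
  GroupSection pullback_subgroup (@trivial_subgroup _)
    (@trivial_normal _ pullback_top).

Definition pullback : cgrp kappa :=
  subquotient_cgrp (prod_invariant kinf (@cgrp_invariant _ X) (@cgrp_invariant _ Y))
    pullback_section.

Definition pullback_pair (t : pullback) : X * Y := sq_repr (t : subquotient pullback_section).

Lemma pullback_pairP t : w (pullback_pair t).1 = f (pullback_pair t).2.
Proof. exact: (@sq_repr_top _ pullback_section). Qed.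

Lemma pullback_pairM : {morph pullback_pair : s t / s * t}.
Proof.
move=> s t; have Ps := @sq_repr_top _ pullback_section s.
have Pt := @sq_repr_top _ pullback_section t.
have := @sq_repr_class _ pullback_section _ (sec_topM Ps Pt).
by move=> /(congr1 (fun p => pullback_pair s * pullback_pair t * p)); rewrite mulVKg mulg1.
Qed.

Lemma pullback_pair_surj x y : w x = f y -> exists t, pullback_pair t = (x, y).
Proof.
move=> Pxy; exists (sq_class pullback_section (x, y)).
have := @sq_repr_class _ pullback_section (x, y) Pxy.
by move=> /(congr1 (fun p => (x, y) * p)); rewrite mulVKg mulg1.
Qed.

Lemma pullback_fstM : {morph (fun t => (pullback_pair t).1) : s t / s * t}.
Proof. by move=> s t /=; rewrite pullback_pairM. Qed.

Lemma pullback_sndM : {morph (fun t => (pullback_pair t).2) : s t / s * t}.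
Proof. by move=> s t /=; rewrite pullback_pairM. Qed.

Lemma pullback_pair_inj : injective pullback_pair.
Proof. exact: can_inj (@sq_reprK _ pullback_section). Qed.

(** The kernel is that of [w].  As for the cosets of the image, [y] and [y'] differ
    by an element of it as soon as [f y] and [f y'] are in the image of [w] up to
    the same error [k]. *)
Lemma pullback_equivalence : cequiv w -> cequiv (morph_hom pullback_sndM).
Proof.
move=> /(coarse_equivalenceP kinf)[kw [K Ks wK]]; apply/(coarse_equivalenceP kinf); split.
  have kp : small (pullback_pair @` [set t | (pullback_pair t).2 = 1]).
    apply: (small_sub _ (small_image (fun x => (x, 1)) kw)).
    move=> _ [t /= t2 <-]; exists (pullback_pair t).1; last by rewrite -t2; case: pullback_pair.
    by rewrite /= pullback_pairP t2 hom1.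
  apply: small_le kp; apply: (@inj_card_leP _ _ _ _ pullback_pair).
    by move=> t t2; exists t.
  by move=> s t _ _ /pullback_pair_inj.
have /choice[s sP] : forall k, exists y, (exists y x, (w x)^-1 * f y = k) ->
    exists x, (w x)^-1 * f y = k.
  move=> k; have [[y yk]|ny] := pselect (exists y x, (w x)^-1 * f y = k); first by exists y.
  by exists 1 => /ny.
exists (s @` K); first exact: small_image.
move=> y; have [x Kx] := wK (f y); set k := (w x)^-1 * f y in Kx.
have [|x0 x0k] := sP k; first by exists y, x.
have fyE : f y = w x * k by rewrite mulVKg.
have fsE : f (s k) = w x0 * k by rewrite -{2}x0k mulVKg.
have [|t tE] := @pullback_pair_surj (x * x0^-1) (y * (s k)^-1).
  by rewrite !gmulfM !homV fyE fsE invgM mulgA mulgK.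
by exists t, k => //; rewrite /= tE /= invgM invgK mulgVK.
Qed.

End Pullback.

End Equivalences.

(** * The left Ore condition *)

Section LeftOre.
Variable kappa : Type.
Hypothesis kinf : infinite_set [set: kappa].
Local Notation small := (@small kappa _).
Local Notation coarse G := (@group_coarse kappa G).
Local Notation cequiv w := (coarse_equivalence (coarse _) (coarse _) w).

Lemma full_subgroup (G : groupType) : subgroup [set: G].
Proof. by []. Qed.

Lemma central_quotient (G : cgrp kappa) (S : set G) : small S ->
  exists (H : cgrp kappa) (p : cgrp_hom G H),
    [/\ cequiv p, forall y, exists x, p x = y & forall s y, S s -> commute (p s) y].
Proof.
move=> Ss; have [M [Ms Msub Mnorm SM]] := small_commutators kinf (@cgrp_invariant _ G) Ss.
pose N := GroupSection (full_subgroup G) Msub Mnorm.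
have piM : {morph sq_class N : x y / x * y} by move=> x y; exact: sq_classM.
have surj y : exists x, sq_class N x = y by exists (sq_repr y); exact: sq_reprK.
pose H := subquotient_cgrp (@cgrp_invariant _ G) N.
pose p : cgrp_hom G H := @morph_hom kappa G H _ piM.
exists H, p.
split=> //.
  apply/(coarse_equivalenceP kinf); split.
    by apply: small_sub Ms => x /sq_class_eq1; exact.
  exists [set 1]; first exact/small_finite/finite_set1.
  by move=> y; have [x <-] := surj y; exists x; rewrite /= mulVg.
move=> s y Ss'; have [x <-] := surj y; apply/commgP/eqP.
rewrite -[sq_class N x]/(p x) -homR /=.
by apply/sq_class_eq1 => //; exact: SM.
Qed.

(** A coarsely equivalent quotient of [X] makes the coset representatives of the
    image of [w] central; their cocycles form a small set, whose image becomes
    central in a coarsely equivalent quotient of [Y].  The span so obtained is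
    completed by [extension]. *)
Theorem left_ore (Z X Y : cgrp kappa) (w : cgrp_hom Z X) (f : cgrp_hom Z Y) : cequiv w ->
  exists (T : cgrp kappa) (w' : cgrp_hom Y T) (f' : cgrp_hom X T),
    cequiv w' /\ forall z, f' (w z) = w' (f z).
Proof.
move=> we; have /(coarse_equivalenceP kinf)[_ [K Ks wK]] := we.
have [X1 [p [pe p_surj pK]]] := central_quotient Ks.
have pwe : cequiv (cgrp_comp p w) by exact: equivalence_comp.
have /(coarse_equivalenceP kinf)[kpw _] := pwe.
have pKs : small (p @` K) by exact: small_image.
have pwK x : exists z, (p @` K) ((cgrp_comp p w z)^-1 * x).
  have [x0 <-] := p_surj x; have [z Kz] := wK x0; exists z.
  by exists ((w z)^-1 * x0) => //=; rewrite gmulfM homV.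
have [r [rK r_coset r_const]] := transversal pwK.
pose S := f @` (cgrp_comp p w @^-1`
  [set k * k' * (r (k * k'))^-1 | k in p @` K & k' in p @` K]).
have Ss : small S.
  by apply/small_image/small_preimage/small_image2.
have [Y1 [q [qe _ qS]]] := central_quotient Ss.
have pK_central k x : (p @` K) k -> commute k x by move=> [k0 Kk0 <-]; exact: pK.
have cocycle z k k' : (p @` K) k -> (p @` K) k' ->
    cgrp_comp p w z * r (k * k') = k * k' -> central_image (cgrp_comp q f) z.
  move=> pk pk' zE y; apply: qS; exists z => //; exists k => //; exists k' => //.
  by rewrite -[X in X / _]zE mulgK.
pose T := extension kinf pK_central rK r_coset r_const cocycle.
exists T, (cgrp_comp (morph_hom (extension_inM kinf pK_central rK r_coset r_const cocycle)) q).
exists (cgrp_comp (morph_hom (extension_mapM kinf pK_central rK r_coset r_const cocycle)) p).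
split; last by move=> z; exact: extension_square.
apply: equivalence_comp => //; exact: extension_in_equivalence.
Qed.

End LeftOre.

(** * The localisation inside the coarse category *)

Section QuotientFunctor.
Variables (C D : category) (R : forall X Y : C, Hom X Y -> Hom X Y -> Prop)
  (S : forall X Y : D, Hom X Y -> Hom X Y -> Prop).
Hypotheses (RC : congruence R) (SD : congruence S).
Variable F : functor C D.
Hypothesis FRS : forall (X Y : C) (f g : Hom X Y), R f g -> S (fmap F f) (fmap F g).

Definition quotient_fmap (X Y : C) (A : quo_hom R X Y) : quo_hom S (F X) (F Y) :=
  quo_class S (fmap F (sval (cid (quo_class_surj A)))).

Lemma quotient_fmapE (X Y : C) (f : Hom X Y) :
  quotient_fmap (quo_class R f) = quo_class S (fmap F f).
Proof.
rewrite /quotient_fmap; case: cid => g /= /(quo_classP RC) fg.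
by apply/(quo_classP SD); apply: (cong_sym SD); exact: FRS.
Qed.

Program Definition quotient_functor :
    functor (quotient_category RC) (quotient_category SD) :=
  @Functor (quotient_category RC) (quotient_category SD) F quotient_fmap _ _.
Next Obligation. by rewrite quotient_fmapE fmap1. Qed.
Next Obligation.
have [a ->] := quo_class_surj f; have [b ->] := quo_class_surj g.
by rewrite quo_compE // !quotient_fmapE fmapM quo_compE.
Qed.

End QuotientFunctor.

Section Main.
Variable kappa : Type.
Hypothesis kinf : infinite_set [set: kappa].
Local Notation coarse G := (@group_coarse kappa G).
Local Notation cequiv w := (coarse_equivalence (coarse _) (coarse _) w).
Local Notation W := (coarse_equivalence_classes kinf).
Local Notation class f := (quo_class (@cgrp_close kappa) f).
Local Notation C := (CGrpQ kinf).
Local Notation CC := (cgrp_close_congruence kinf).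

Lemma class_equivalence (X Y : cgrp kappa) (f : cgrp_hom X Y) :
  @coarse_equivalence_classes kappa kinf X Y (class f) <-> cequiv f.
Proof.
split=> [[g [/(quo_classP CC) fg ge]]|fe]; last by exists f.
exact: equivalence_close (close_sym fg) ge.
Qed.

Lemma homotopical_classes : homotopical W.
Proof.
split.
- by move=> X; apply/class_equivalence; exact: equivalence_id.
- move=> X Y Z g f; have [g' ->] := quo_class_surj g; have [f' ->] := quo_class_surj f.
  move=> /class_equivalence ge /class_equivalence fe.
  by rewrite /= quo_compE; apply/class_equivalence; exact: equivalence_comp.
- move=> X Y Z w f; have [w' ->] := quo_class_surj w; have [f' ->] := quo_class_surj f.
  move=> /class_equivalence we.
  exists (pullback kinf w' f'), (class (morph_hom (pullback_sndM (w:=w') (f:=f')))),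
    (class (morph_hom (pullback_fstM (w:=w') (f:=f')))).
  split; first by apply/class_equivalence; exact: pullback_equivalence.
  rewrite /= !quo_compE; congr quo_class; apply: cgrp_hom_eq => t /=.
  exact: pullback_pairP.
- move=> X Y Z w f g; have [w' ->] := quo_class_surj w; have [f' ->] := quo_class_surj f.
  have [g' ->] := quo_class_surj g.
  move=> /class_equivalence we; rewrite /= !quo_compE => /(quo_classP CC) wfg.
  exists X, (idc (X : C)); split; first by apply/class_equivalence; exact: equivalence_id.
  suff -> : class f' = class g' by [].
  by apply/(quo_classP CC); exact: equivalence_monic we wfg.
- move=> X Y Z T f g h; have [f' ->] := quo_class_surj f; have [g' ->] := quo_class_surj g.
  have [h' ->] := quo_class_surj h.
  rewrite /= !quo_compE => /class_equivalence gf /class_equivalence hg.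
  have [fe ge he] := equivalence_2of6 kinf gf hg.
  by split; apply/class_equivalence.
Qed.

Lemma left_ore_classes (X Y Z : C) (w : Hom Z X) (f : Hom Z Y) :
  @coarse_equivalence_classes kappa kinf _ _ w ->
  exists (T : C) (w' : Hom Y T) (f' : Hom X T),
    @coarse_equivalence_classes kappa kinf _ _ w' /\ f' \oc w = w' \oc f.
Proof.
have [w0 ->] := quo_class_surj w; have [f0 ->] := quo_class_surj f.
move=> /class_equivalence we; have [T [w' [f' [w'e sq]]]] := left_ore kinf f0 we.
exists T, (class w'), (class f'); split; first exact/class_equivalence.
by rewrite /= !quo_compE; congr quo_class; apply: cgrp_hom_eq.
Qed.

(** The localisation is realised by genuine maps, not by equivalence classes of
    spans: as coarse equivalences are invertible in the coarse category, the
    fraction [f / w] is the map [f] composed with a coarse inverse of [w].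
    Composition is then associative by nature, and faithfulness of the
    embedding of homomorphisms holds by construction. *)
Record fraction_map (X Y : cgrp kappa) := FractionMap {
  fraction_fun :> X -> Y;
  fraction_bornologous : bornologous (coarse X) (coarse Y) fraction_fun;
  fraction_hom : exists (T : cgrp kappa) (w : cgrp_hom T X) (f : cgrp_hom T Y),
    cequiv w /\ close (coarse Y) (fraction_fun \o w) f
}.

Lemma fraction_map_eq (X Y : cgrp kappa) (u v : fraction_map X Y) : u =1 v -> u = v.
Proof.
case: u v => u ub uf [v vb vf] /= /funext uv; case: v / uv vb vf => vb vf.
by congr FractionMap; exact: Prop_irrelevance.
Qed.

Lemma hom_fraction (X Y : cgrp kappa) (f : cgrp_hom X Y) :
  exists (T : cgrp kappa) (w : cgrp_hom T X) (f' : cgrp_hom T Y),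
    cequiv w /\ close (coarse Y) (f \o w) f'.
Proof.
by exists X, (cgrp_id X), f; split; [exact: equivalence_id|exact: close_refl].
Qed.

Definition map_of_hom (X Y : cgrp kappa) (f : cgrp_hom X Y) : fraction_map X Y :=
  FractionMap (cgrp_bornologous f) (hom_fraction f).

Lemma bornologous_comp (X Y Z : Type) (EX : set (set (X * X))) (EY : set (set (Y * Y)))
    (EZ : set (set (Z * Z))) (v : Y -> Z) (u : X -> Y) :
  bornologous EY EZ v -> bornologous EX EY u -> bornologous EX EZ (v \o u).
Proof. by move=> vb ub E /ub/vb; rewrite image_comp. Qed.

(** Two fractions are composed by means of the pullback of the middle span. *)
Lemma comp_fraction (X Y Z : cgrp kappa) (v : fraction_map Y Z) (u : fraction_map X Y) :
  exists (T : cgrp kappa) (w : cgrp_hom T X) (f : cgrp_hom T Z),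
    cequiv w /\ close (coarse Z) ((v \o u) \o w) f.
Proof.
have [T [w [f [we uwf]]]] := fraction_hom u.
have [T' [w' [g [we' vwg]]]] := fraction_hom v.
have we'' := pullback_equivalence kinf f we'.
pose p2 := morph_hom (pullback_sndM (kinf:=kinf) (w:=w') (f:=f)).
pose p1 := morph_hom (pullback_fstM (kinf:=kinf) (w:=w') (f:=f)).
exists (pullback kinf w' f), (cgrp_comp w p2), (cgrp_comp g p1); split.
  exact: equivalence_comp.
apply: (@group_close_trans _ _ _ _ (v \o (f \o p2))) => //.
  apply: (close_comp_l (fraction_bornologous v)).
  exact: (close_comp_r p2 uwf).
have -> : v \o (f \o p2) = (v \o w') \o p1.
  by apply: funext => t /=; rewrite (pullback_pairP t).
exact: (close_comp_r p1 vwg).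
Qed.

Definition fraction_comp (X Y Z : cgrp kappa) (v : fraction_map Y Z) (u : fraction_map X Y) :
    fraction_map X Z :=
  FractionMap (bornologous_comp (fraction_bornologous v) (fraction_bornologous u))
    (comp_fraction v u).

Program Definition FractionCGrp : category :=
  @Category (cgrp kappa) fraction_map (fun X => map_of_hom (cgrp_id X)) fraction_comp _ _ _.
Next Obligation. exact: fraction_map_eq. Qed.
Next Obligation. exact: fraction_map_eq. Qed.
Next Obligation. exact: fraction_map_eq. Qed.

Definition fraction_close (X Y : FractionCGrp) (u v : Hom X Y) :=
  close (coarse (Y : cgrp kappa)) (u : fraction_map X Y) (v : fraction_map X Y).

Lemma fraction_close_congruence : congruence fraction_close.
Proof.
split.
- by move=> X Y u; exact: close_refl.
- by move=> X Y u v; exact: close_sym.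
- by move=> X Y u v t; exact: group_close_trans.
- move=> X Y Z v v' u u' vv' uu'.
  apply: (@group_close_trans _ _ _ _ ((v : fraction_map _ _) \o (u' : fraction_map _ _))) => //.
    exact: (close_comp_l (fraction_bornologous (v : fraction_map Y Z)) uu').
  exact: (close_comp_r (u' : fraction_map X Y) vv').
Qed.

Program Definition hom_to_map : functor (CGrp kappa) FractionCGrp :=
  @Functor (CGrp kappa) FractionCGrp id map_of_hom _ _.
Next Obligation. exact: fraction_map_eq. Qed.

Definition FractionCGrpQ := quotient_category fraction_close_congruence.

Lemma hom_to_map_close (X Y : CGrp kappa) (f g : Hom X Y) :
  cgrp_close f g -> fraction_close (fmap hom_to_map f) (fmap hom_to_map g).
Proof. by []. Qed.

Definition coarse_embedding : functor C FractionCGrpQ :=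
  quotient_functor CC fraction_close_congruence hom_to_map_close.

Lemma coarse_embeddingE (X Y : CGrp kappa) (f : Hom X Y) :
  fmap coarse_embedding (class f : @Hom C X Y) = quo_class fraction_close (fmap hom_to_map f).
Proof. exact: (quotient_fmapE CC fraction_close_congruence hom_to_map_close). Qed.

Lemma coarse_embedding_fraction_functor : fraction_functor W coarse_embedding.
Proof.
split.
- move=> X Y w; have [w0 ->] := quo_class_surj w => /class_equivalence we.
  have [_ [g [gb gw wg]]] := we.
  pose g' : fraction_map Y X := FractionMap gb (ex_intro _ (X : cgrp kappa)
    (ex_intro _ w0 (ex_intro _ (cgrp_id X) (conj we gw)))).
  exists (quo_class fraction_close (g' : @Hom FractionCGrp Y X)).
  rewrite coarse_embeddingE /= !quo_compE; split; apply/(quo_classP fraction_close_congruence).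
    exact: gw.
  exact: wg.
- move=> X Y f g; have [f0 ->] := quo_class_surj f; have [g0 ->] := quo_class_surj g.
  rewrite !coarse_embeddingE.
  by move=> /(quo_classP fraction_close_congruence) fg; apply/(quo_classP CC).
- by move=> X; exists X; exists (idc (X : FractionCGrpQ)); exact: iso_id.
- move=> X Y u; have [u0 ->] := quo_class_surj u.
  have [T [w [f [we uwf]]]] := fraction_hom (u0 : fraction_map X Y).
  exists T, (class w), (class f); split; first exact/class_equivalence.
  by rewrite !coarse_embeddingE /= quo_compE; apply/(quo_classP fraction_close_congruence).
Qed.

End Main.

Theorem corollary5p14 (kappa : Type) (kinf : infinite_set [set: kappa]) :
  homotopical (coarse_equivalence_classes kinf) /\
  (exists (L : category) (Q : functor (CGrpQ kinf) L),
     localisation (coarse_equivalence_classes kinf) Q) /\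
  (forall (L : category) (Q : functor (CGrpQ kinf) L),
     localisation (coarse_equivalence_classes kinf) Q -> exact_functor Q).
Proof.
have hW := homotopical_classes kinf.
have f0 := coarse_embedding_fraction_functor kinf.
have l0 := fraction_functor_localisation hW f0.
split; [exact: hW|split]; first by exists (FractionCGrpQ kinf), (coarse_embedding kinf).
move=> L Q lQ; have fQ := localisation_fraction_functor f0 l0 lQ.
exact: (fraction_functor_exact hW fQ (@left_ore_classes _ kinf)).
Qed.
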